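(* For the sequence $\{\gamma^{(n)}\}_{n\ge 1}$, where $\gamma=\gamma^{(1)}$: (i) at least one element of the pair $\{\gamma,\gamma^{(2)}\}$ is transcendental; (ii) $\gamma^{(2n)}\in\mathbb{Q}\left[\gamma,\gamma^{(2)},\gamma^{(3)},\ldots,\gamma^{(2n-1)}\right]$ for all integers $n\ge 2$; (iii) $\gamma^{(n)}$ is transcendental for infinitely many $n$; and (iv) for all integers $N\ge 1$, $$\frac{\#\left\{n\in\{1,2,\ldots,N\}:\gamma^{(n)}\text{ is transcendental}\right\}}{N}\ \ge\ \beta(N)=\frac{\max\left\{0,\sqrt{N-1}-3/2\right\}}{N},$$ where $\beta(N)\asymp N^{-1/2}$ as $N\to\infty$.
   Context: For integers $n\ge 0$, the generalized Euler-Mascheroni constants are $$\gamma^{(n)}=\int_{-\infty}^{\infty}x^n\exp\left(-x-e^{-x}\right)dx=(-1)^n\Gamma^{(n)}(1),$$ where $\Gamma^{(n)}(1)$ is the $n$-th derivative of the Gamma function at $1$; in particular $\gamma^{(0)}=1$ and $\gamma^{(1)}=\gamma=0.577215\ldots$ is the Euler-Mascheroni constant. ''Transcendental'' means transcendental over $\mathbb{Q}$. $\mathbb{Q}[a_1,\ldots,a_k]$ denotes the set of real numbers expressible as polynomials in $a_1,\ldots,a_k$ with rational coefficients. The notation $f(N)\asymp g(N)$ as $N\to\infty$ means that $f(N)/g(N)$ is bounded above and below by positive constants for all sufficiently large $N$. *)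

(* Defs.v *)
From HB Require Import structures.
From mathcomp Require Import all_boot all_order all_algebra.
From mathcomp Require Import all_classical all_reals all_analysis.
(* Not imported: its notations clash with those of MathComp-Analysis. *)
From mathcomp Require mpoly.

Set Implicit Arguments.
Unset Strict Implicit.
Unset Printing Implicit Defensive.

Import Order.TTheory GRing.Theory Num.Theory.
Import numFieldNormedType.Exports.

Local Open Scope classical_set_scope.
Local Open Scope ring_scope.

Definition gamma_const (R : realType) (n : nat) : R :=
  Rintegral (@lebesgue_measure R) setT
    (fun x : R => x ^+ n * expR (- x - expR (- x))).

Definition transcendental (R : realType) (x : R) : Prop :=
  ~ algebraicOver (ratr : rat -> R) x.

(* Q[a_0, ..., a_(k-1)], as the values at a of the polynomials in k variables
   with rational coefficients. *)
Definition Qpoly (R : realType) (k : nat) (a : 'I_k -> R) : set R :=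
  [set x | exists p : mpoly.mpoly k rat, x = mpoly.mmap (ratr : rat -> R) a p].

Definition transcendental_count (R : realType) (N : nat) : nat :=
  count (fun n : nat => `[< transcendental (gamma_const R n) >])
    (index_iota 1 N.+1).

Definition beta (R : realType) (N : nat) : R :=
  Num.max 0 (Num.sqrt (N%:R - 1) - 3 / 2) / N%:R.

Definition asymp (R : realType) (f g : nat -> R) : Prop :=
  exists c C : R, [/\ 0 < c, 0 < C &
    \forall N \near \oo, c <= f N / g N <= C].

(* Main.v *)
Require Import Defs.
From HB Require Import structures.
From mathcomp Require Import all_boot all_order all_algebra.
From mathcomp Require Import all_classical all_reals all_analysis.
From mathcomp Require Import measurable_realfun perm complex ring lra zify.
(* Importing the notations of mpoly would clash with MathComp-Analysis. *)
From mathcomp Require mpoly.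
Import (canonicals, coercions) mpoly.

Set Implicit Arguments.
Unset Strict Implicit.
Unset Printing Implicit Defensive.

Import Order.TTheory GRing.Theory Num.Theory.
Import numFieldNormedType.Exports.

Local Open Scope classical_set_scope.
Local Open Scope ring_scope.

(** With w(x) = exp(-x - e^(-x)), Tonelli's theorem turns the alternating sum of
    C(2n,k) gamma^(k) gamma^(2n-k) into the 2n-th moment of the correlation
    s |-> int w(x) w(x+s) dx, which is sech^2(s/2)/4.  The moments N_n of sech^2
    and S_n of sech are computed by two more correlations: sech with itself gives
    2s/sinh s, whose moments are rational multiples of N_(n+1) (compare the
    integrals of x^m/(e^x-1) and x^m/(e^x+1)), and sech^2 with sech gives
    (pi/2) sech^2(s/2).  By induction N_n is in Q pi^(2n) and S_n in Q pi^(2n+1),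
    so every alternating sum is a positive rational multiple of pi^(2n).

    If m of the numbers gamma^(1), ..., gamma^(N) are transcendental, then these
    sums, for 0 <= n <= N/2, lie in the span over the algebraic numbers of the
    C(m+2,2) products of two elements of {1} and those m numbers; as pi is
    transcendental the powers of pi^2 are linearly independent over the algebraic
    numbers, so N/2 + 1 <= C(m+2,2).  The transcendence of pi is proved by
    Hermite's method, as in Lindemann's theorem. *)

(** * Integrals over the real line *)

Section int.
Context {R : realType}.
Local Notation mu := (@lebesgue_measure R).
Implicit Types f F g : R -> R.

(** The Gumbel moments could be treated through the reflection formula for Gamma and the even zeta
    values; here every correlation has an elementary primitive instead, and pi enters only as a
    limit of arctangents. Neither identity for sech and sech^2 suffices alone: the first yields
    N_(2n+2) from S_0, ..., S_(2n), and the second then contains S_(2n+2) only in its term k = 0,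
    with coefficient N_0 = 2, so the two recursions alternate. Integrals are compared as extended
    reals with nonnegative integrands, since even exponents give the sign while finiteness is
    sometimes known only at the end. The rational factor must be nonzero: it is inverted at n = 1 to
    express pi^2 by gamma and gamma^(2), which eliminates pi from the relation for gamma^(2n), and
    it keeps the scaled powers of pi^2 independent. As for pi itself, the conjugates of i pi are
    unknown, but the product of 1 + exp over all of them vanishes, and expanding it gives a sum over
    subsets whose data are symmetric in the conjugates, hence integral up to a denominator. *)

Lemma is_derive_continuous f (x d : R) : is_derive x 1 f d -> {for x, continuous f}.
Proof. by case=> + _; move/derivable1_diffP/differentiable_continuous. Qed.

Lemma integralT_split f : (forall x, 0 <= f x) -> continuous f ->
  (\int[mu]_x (f x)%:E = \int[mu]_(x in `[0%R, +oo[) (f x)%:E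
    + \int[mu]_(x in `[0%R, +oo[) (f (- x))%:E)%E.
Proof.
move=> f0 cf.
have mf : measurable_fun [set: R] f by exact: continuous_measurable_fun.
rewrite -(setUv `[0%R, +oo[%classic) ge0_integral_setU//=; last 4 first.
- exact: measurableC.
- by apply/measurable_EFinP; rewrite setUv.
- by move=> x _; rewrite lee_fin.
- exact/disj_setPCl.
congr (_ + _)%E.
rewrite setCitvr integral_itv_bndo_bndc; last exact/measurable_EFinP/measurable_funTS.
by rewrite -{1}oppr0 ge0_integration_by_substitutionNy//; exact: continuous_subspaceT.
Qed.

(** Nonnegativity yields convergence of the integral together with its value, so the explicit
    primitives of the correlations need no separate integrability argument. *)
Lemma ge0_continuous_FTC2T f F (l l' : R) : (forall x, 0 <= f x) ->
  continuous f -> (forall x : R, is_derive x 1 F (f x)) ->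
  F x @[x --> +oo%R] --> l -> F x @[x --> -oo%R] --> l' ->
  (\int[mu]_x (f x)%:E = (l - l')%:E)%E.
Proof.
move=> f0 cf dF Fl Fl'; rewrite (integralT_split f0 cf).
have cF : continuous F by move=> x; apply: is_derive_continuous (dF x).
rewrite (@ge0_continuous_FTC2y _ f F 0 l)//; last 3 first.
- exact: continuous_subspaceT.
- by apply: cvg_at_right_filter; exact: cF.
- by move=> x _; rewrite derive1E; case: (dF x).
have dG (x : R) : is_derive x 1 (fun y => - F (- y)) (f (- x)).
  have := dF (- x) => dFx.
  by apply: is_derive_eq; ring.
have -> : (\int[mu]_(x in `[0%R, +oo[) (f (- x))%:E = (- l')%:E - (- F (- 0))%:E)%E.
  apply: (@ge0_continuous_FTC2y _ (fun x => f (- x)) (fun x => - F (- x))) => //.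
  - apply: continuous_subspaceT => x.
    by apply: continuous_comp; [exact: opp_continuous|exact: cf].
  - by apply: cvgN; move/cvgNy_compNP: Fl'.
  - apply: cvg_at_right_filter; exact: (is_derive_continuous (dG 0)).
  - by move=> x _; rewrite derive1E; case: (dG x).
by rewrite oppr0 -!EFinB -EFinD; congr EFin; ring.
Qed.
End int.

(** * Moments of exponentially decaying functions and their correlations *)

Section moments.
Context {R : realType}.
Local Notation mu := (@lebesgue_measure R).
Implicit Types f g h : R -> R.

Definition moment f (k : nat) : R := Rintegral mu setT (fun x => x ^+ k * f x).

(** Bundles what the correlation argument consumes: measurability, a sign for Tonelli, and
    integrability against every power. *)
Definition exp_decay f : Prop :=
  [/\ continuous f, forall x, 0 <= f x &
      exists C : R, forall x, f x <= C * expR (- `|x|)].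

Lemma integrable_oneDsqrV : mu.-integrable setT (fun x : R => ((oneDsqr x)^-1)%:E).
Proof.
have c : continuous (fun x : R => (oneDsqr x)^-1) by exact: continuous_oneDsqrV.
have p (x : R) : 0 <= (oneDsqr x)^-1 by rewrite invr_ge0 ltW ?oneDsqr_gt0.
apply/integrableP; split.
  by apply/measurable_EFinP; exact: continuous_measurable_fun.
under eq_integral do rewrite gee0_abs ?lee_fin//.
rewrite integralT_split//.
under [X in (_ + X)%E]eq_integral do rewrite /oneDsqr sqrrN -/(oneDsqr _).
by rewrite integral0y_oneDsqr -EFinD ltry.
Qed.

Lemma pow_le_expR (x : R) k : `|x| ^+ k <= k`!%:R * expR `|x|.
Proof.
case: k => [|k].
  by rewrite expr0 fact0 mul1r -expR0 ler_expR.
rewrite mulrC -ler_pdivrMr ?ltr0n ?fact_gt0//.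
by apply: le_trans (expR_ge1Dxn k (normr_ge0 x)); rewrite lerDr.
Qed.

Lemma integrable_moment f k : exp_decay f ->
  mu.-integrable setT (fun x => (x ^+ k * f x)%:E).
Proof.
case=> cf f0 [C fC].
have C0 : 0 <= C by have := le_trans (f0 0) (fC 0); rewrite normr0 oppr0 expR0 mulr1.
(* Multiplying [|x| ^+ k] by [oneDsqr x] gives the powers [k] and [k.+2], each at most its factorial
   times the exponential of [|x|]. *)
pose K : R := C * (k`!%:R + k.+2`!%:R).
have K0 : 0 <= K by rewrite mulr_ge0// addr_ge0.
apply: (@le_integrable _ _ _ mu setT measurableT _ (fun x : R => K%:E * ((oneDsqr
  x)^-1)%:E)%E).
- apply/measurable_EFinP; apply: continuous_measurable_fun => x.
  by apply: cvgM; [exact: exprn_continuous|exact: cf].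
- move=> x _; rewrite -EFinM !abse_EFin lee_fin [leRHS]ger0_norm; last first.
    by rewrite mulr_ge0// invr_ge0 ltW ?oneDsqr_gt0.
  rewrite ler_pdivlMr ?oneDsqr_gt0// normrM normrX (ger0_norm (f0 x)).
  rewrite (@le_trans _ _ (`|x| ^+ k * (C * expR (- `|x|)) * oneDsqr x))//.
    by rewrite ler_wpM2r ?(ltW (oneDsqr_gt0 _))// ler_wpM2l// exprn_ge0.
  have -> : `|x| ^+ k * (C * expR (- `|x|)) * oneDsqr x =
      C * expR (- `|x|) * (`|x| ^+ k + `|x| ^+ k.+2).
    by rewrite /oneDsqr -[x ^+ 2]real_normK ?num_real// !exprS expr0; ring.
  rewrite /K -mulrA ler_wpM2l// expRN mulrC ler_pdivrMr ?expR_gt0// mulrDl.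
  by rewrite lerD// pow_le_expR.
- exact: integrableZl integrable_oneDsqrV.
Qed.

Lemma integral_lincomb (n : nat) (c : nat -> R) (phi : nat -> R -> R) :
  (forall i, mu.-integrable setT (EFin \o phi i)) ->
  (\int[mu]_x (\sum_(i < n) c i * phi i x)%:E =
   (\sum_(i < n) c i * Rintegral mu setT (phi i))%:E)%E.
Proof.
move=> iphi.
under eq_integral do rewrite -sumEFin.
rewrite integral_sum//; last first.
  by move=> i; apply: (integrableZl _ (c i) (iphi i)).
rewrite -sumEFin; apply: eq_bigr => i _.
under eq_integral do rewrite EFinM.
rewrite integralZl//; last exact: iphi.
by rewrite EFinM /Rintegral fineK//; apply: integrable_fin_num => //; exact: iphi.
Qed.

(* The value at [s = 0] is left free because the closed forms of the
   correlations used below, such as [s / sinh s], are junk there. *)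
Lemma correlation_moment f g h n : exp_decay f -> exp_decay g ->
  measurable_fun setT h ->
  (forall s, s != 0 -> (\int[mu]_x (f x * g (x + s))%:E = (h s)%:E)%E) ->
  (\int[mu]_s (s ^+ n.*2 * h s)%:E =
   (\sum_(k < n.*2.+1) (-1) ^+ k * 'C(n.*2, k)%:R * moment f k
      * moment g (n.*2 - k))%:E)%E.
Proof.
move=> df dg mh fgh; have [cf f0 _] := df; have [cg g0 _] := dg.
have mf : measurable_fun setT f by exact: continuous_measurable_fun.
have mg : measurable_fun setT g by exact: continuous_measurable_fun.
have sq0 (x : R) : 0 <= x ^+ n.*2 by rewrite exprn_even_ge0// odd_double.
pose phi (z : R * R) := (z.1 ^+ n.*2 * (f z.2 * g (z.2 + z.1)))%:E.
have phi0 z : (0 <= phi z)%E by rewrite lee_fin !mulr_ge0.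
have mphi : measurable_fun setT phi.
  apply/measurable_EFinP; apply: measurable_funM.
    by apply: measurable_funX; exact: measurable_fst.
  apply: measurable_funM; first by apply: measurableT_comp => //; exact: measurable_snd.
  by apply: measurableT_comp => //; exact: measurable_funD.
transitivity (\int[mu]_s \int[mu]_x phi (s, x))%E.
  (* The correlation is known only for [s != 0]; the point 0 is removed from both integrals as a
     null set. *)
  have mD0 : measurable (setT `\ 0 : set R) by exact: measurableD.
  rewrite -[LHS](@integral_setD1 _ _ 0)//; last first.
    by apply/measurable_EFinP; apply: measurable_funTS; apply: measurable_funM.
  rewrite -[RHS](@integral_setD1 _ _ 0)//; last first.
    by apply: measurable_funTS; exact: measurable_fun_fubini_tonelli_F.
  apply: eq_integral => s; rewrite inE/= => -[_ /eqP s0].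
  rewrite EFinM -fgh// -ge0_integralZl ?lee_fin//.
  - apply/measurable_EFinP; apply: measurable_funM => //.
    by apply: measurableT_comp => //; exact: measurable_funD.
  - by move=> x _; rewrite lee_fin mulr_ge0.
rewrite fubini_tonelli//.
transitivity (\int[mu]_x (\sum_(k < n.*2.+1) ((-1) ^+ k * 'C(n.*2, k)%:R * moment g (n.*2
  - k)) *
    (x ^+ k * f x))%:E)%E; last first.
  rewrite (integral_lincomb _ (fun k => (-1) ^+ k * 'C(n.*2, k)%:R * moment g (n.*2 - k))
    (fun k => integrable_moment k df)).
  by congr EFin; apply: eq_bigr => k _; rewrite -/(moment f k) -!mulrA (mulrC (moment g _)).
apply: eq_integral => x _.
rewrite /phi/=.
(* With [y = x + s] the factor [s ^+ n.*2] becomes [(y - x) ^+ n.*2], whose binomial expansion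
   separates the variables. *)
pose G y := (y - x) ^+ n.*2 * (f x * g y).
transitivity (\int[mu]_y (G y)%:E)%E.
  have dF (s : R) : is_derive s 1 (fun s => s + x) 1.
    by apply: is_derive_eq; rewrite addr0.
  have dF1 : derive1 (fun s => s + x) = cst (1 : R).
    by apply/funext => s; rewrite derive1E; case: (dF s).
  rewrite (@increasing_ge0_integration_by_substitutionT _ (fun s => s + x) G) ?dF1//.
  - apply: eq_integral => s _; congr EFin.
    by rewrite [RHS]mulr1 /G /= addrK (addrC s).
  - by move=> a b; rewrite ltrD2r.
  - by move=> s; exact: cvg_cst.
  - exact: is_cvg_cst.
  - exact: is_cvg_cst.
  - exact: cvg_addrr_Ny.
  - exact: cvg_addrr.
  - move=> y; apply: cvgM; last by apply: cvgM; [exact: cvg_cst|exact: cg].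
    apply: (@continuous_comp _ _ _ (fun y : R => y - x) (fun y : R => y ^+ n.*2));
      last exact: exprn_continuous.
    by apply: cvgB; [exact: cvg_id|exact: cvg_cst].
  - by move=> y; rewrite !mulr_ge0.
transitivity (\int[mu]_y (\sum_(k < n.*2.+1) ((-1) ^+ k * 'C(n.*2, k)%:R * x ^+ k * f x) *
    (y ^+ (n.*2 - k) * g y))%:E)%E.
  apply: eq_integral => y _; congr EFin; rewrite /G exprBn mulr_suml.
  apply: eq_bigr => k _; rewrite -mulr_natr; ring.
rewrite (integral_lincomb _ (fun k => (-1) ^+ k * 'C(n.*2, k)%:R * x ^+ k * f x)
  (fun k => integrable_moment (n.*2 - k) dg)).
congr EFin; apply: eq_bigr => k _; rewrite -/(moment g _); ring.
Qed.

End moments.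

(** * The hyperbolic secant, the hyperbolic tangent and the Gumbel density *)

Section special_functions.
Context {R : realType}.
Local Notation mu := (@lebesgue_measure R).
Implicit Types (x s p a : R).

Definition sech x : R := 2 / (expR x + expR (- x)).
(** The density of the Gumbel distribution; its [n]-th moment is [gamma_const R n]. *)
Definition gumbel x : R := expR (- x - expR (- x)).

Lemma cosh2_gt0 x : 0 < expR x + expR (- x).
Proof. by rewrite addr_gt0 ?expR_gt0. Qed.

Lemma sech_gt0 x : 0 < sech x.
Proof. by rewrite divr_gt0 ?cosh2_gt0. Qed.

Lemma sechN x : sech (- x) = sech x.
Proof. by rewrite /sech opprK addrC. Qed.

Lemma continuous_sech : continuous sech.
Proof.
move=> x; apply: cvgM; first exact: cvg_cst.
apply: cvgV; first by rewrite gt_eqF// cosh2_gt0.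
apply: cvgD; first exact: continuous_expR.
by apply: continuous_comp; [exact: opp_continuous|exact: continuous_expR].
Qed.

Lemma sech_le x : sech x <= 2 * expR (- `|x|).
Proof.
wlog x0 : x / 0 <= x => [th|].
  by have [/th//|/ltW x0] := leP 0 x; rewrite -sechN -normrN th// oppr_ge0.
rewrite ger0_norm// /sech ler_pM2l// [leRHS]expRN lef_pV2 ?posrE ?cosh2_gt0 ?expR_gt0//.
by rewrite lerDl expR_ge0.
Qed.

Lemma exp_decay_sech : exp_decay sech.
Proof.
split; [exact: continuous_sech|by move=> x; rewrite ltW ?sech_gt0|].
by exists 2; exact: sech_le.
Qed.

Lemma exp_decay_sech2 : exp_decay (fun x => sech x ^+ 2).
Proof.
split.
- by move=> x; apply: cvgM; exact: continuous_sech.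
- by move=> x; rewrite sqr_ge0.
exists 4 => x; apply: (@le_trans _ _ ((2 * expR (- `|x|)) ^+ 2)).
  by rewrite ler_pXn2r ?nnegrE ?mulr_ge0 ?expR_ge0 ?(ltW (sech_gt0 _))// sech_le.
have e1 : expR (- `|x|) <= 1 by rewrite expR_le1 oppr_le0.
have e0 := expR_ge0 (- `|x|).
by nra.
Qed.

Lemma continuous_gumbel : continuous gumbel.
Proof.
move=> x; apply: continuous_comp; last exact: continuous_expR.
apply: cvgB; first exact: opp_continuous.
by apply: continuous_comp; [exact: opp_continuous|exact: continuous_expR].
Qed.

Lemma exp_decay_gumbel : exp_decay gumbel.
Proof.
split; [exact: continuous_gumbel|by move=> x; rewrite /gumbel expR_ge0|].
exists (expR 1) => x; rewrite -expRD ler_expR.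
have [x0|x0] := leP 0 x.
  by rewrite ger0_norm//; have := expR_ge0 (- x); lra.
(* For [y = - x], the square [(y - 2) ^+ 2] being nonnegative gives
   [2 * y - 1 <= 1 + y ^+ 2 / 2 <= expR y]. *)
rewrite ltr0_norm//; have /(expR_ge1Dxn 1) : 0 <= - x by lra.
have := sqr_ge0 (x + 2); rewrite sqrrN (_ : 2`!%:R = 2)//.
set e := expR (- x); rewrite !expr2 => h1 h2; lra.
Qed.

Lemma cvgy_expRN : expR (- x) @[x --> +oo] --> (0 : R).
Proof. exact: cvgr_expR. Qed.

Lemma cvgNy_expR : expR x @[x --> -oo] --> (0 : R).
Proof. by apply/cvgNy_compNP; exact: cvgr_expR. Qed.

Lemma cvgy_expR : @expR R x @[x --> +oo] --> +oo.
Proof.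
apply: (@ger_cvgy _ _ _ _ id); last exact: cvg_id.
by near=> x; apply: le_trans (expR_ge1Dx x); rewrite lerDr.
Unshelve. all: by end_near. Qed.

(** With [q = expR (- x)] a limit at infinity becomes a value at [q = 0], where no indeterminate
    form remains. *)
Lemma cvgy_comp_expRN (F G : R -> R) : {for 0, continuous G} ->
  (forall x, F x = G (expR (- x))) -> F x @[x --> +oo] --> G 0.
Proof. by move=> cG /funext ->; exact: (cvg_comp _ _ cvgy_expRN cG). Qed.

Lemma cvgNy_comp_expR (F G : R -> R) : {for 0, continuous G} ->
  (forall x, F x = G (expR x)) -> F x @[x --> -oo] --> G 0.
Proof. by move=> cG /funext ->; exact: (cvg_comp _ _ cvgNy_expR cG). Qed.

Definition tanh x : R := (expR x - expR (- x)) / (expR x + expR (- x)).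

Lemma is_derive_cosh2V x : is_derive x 1 (fun x => (expR x + expR (- x))^-1)
  (- (expR x - expR (- x)) / (expR x + expR (- x)) ^+ 2).
Proof.
have d : is_derive x 1 (fun x => expR x + expR (- x)) (expR x - expR (- x)).
  by apply: is_derive_eq; rewrite mulrN1.
apply: is_derive_eq; first by apply: is_deriveV; rewrite gt_eqF// cosh2_gt0.
by rewrite /GRing.scale/=; field; rewrite gt_eqF// cosh2_gt0.
Qed.

Global Instance is_derive_tanh x : is_derive x 1 tanh (sech x ^+ 2).
Proof.
have dV := is_derive_cosh2V x.
apply: is_derive_eq.
rewrite /sech expRN /GRing.scale/=; have := expR_gt0 x; set p := expR x => p0.
field; rewrite gt_eqF//=; last by nra.
Qed.

(** The primitive [2 * atan (expR x)] runs from 0 to [pi]; this starts the recursion for the moments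
    of [sech]. *)
Lemma moment0_sech : moment sech 0 = pi.
Proof.
rewrite /moment /Rintegral.
under eq_integral do rewrite expr0 mul1r.
have dF (x : R) : is_derive x 1 (fun x => 2 * atan (expR x)) (sech x).
  apply: is_derive_eq.
  rewrite /sech expRN /GRing.scale/=; have := expR_gt0 x; set p := expR x => p0.
  by field; rewrite gt_eqF//=; nra.
rewrite (@ge0_continuous_FTC2T _ _ (fun x => 2 * atan (expR x)) pi 0 _ _ dF)/= ?subr0//.
- by move=> x; rewrite ltW ?sech_gt0.
- exact: continuous_sech.
- rewrite (_ : pi = 2 * (pi / 2)); last by field.
  apply: cvgM; first exact: cvg_cst.
  exact: (cvg_comp _ _ cvgy_expR (@cvgy_atan R)).
- rewrite (_ : 0 = 2 * atan 0); last by rewrite atan0 mulr0.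
  by apply: (cvgNy_comp_expR (G := fun p => 2 * atan p)) => //; apply: cvgM;
    [exact: cvg_cst|exact: continuous_atan].
Qed.

Lemma cvgy_tanh : tanh x @[x --> +oo] --> (1 : R).
Proof.
rewrite (_ : 1 = (1 - 0 ^+ 2) / (1 + 0 ^+ 2)); last by rewrite expr0n subr0 addr0 divr1.
apply: (cvgy_comp_expRN (G := fun q : R => (1 - q ^+ 2) / (1 + q ^+ 2))).
  apply: cvgM; first by apply: cvgB; [exact: cvg_cst|exact: exprn_continuous].
  by apply: cvgV; [rewrite expr0n addr0 oner_eq0|apply: cvgD;
    [exact: cvg_cst|exact: exprn_continuous]].
move=> x; rewrite /tanh expRN; have := expR_gt0 x; set p := expR x => p0.
field; rewrite gt_eqF//=; last by nra.
Qed.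

Lemma tanhN x : tanh (- x) = - tanh x.
Proof. by rewrite /tanh opprK -mulNr opprB (addrC (expR (- x)) (expR x)). Qed.

Lemma cvgNy_tanh : tanh x @[x --> -oo] --> (-1 : R).
Proof.
apply/cvgNy_compNP; rewrite (_ : tanh \o -%R = fun x => - tanh x).
  by apply: cvgN; exact: cvgy_tanh.
by apply/funext => x /=; rewrite tanhN.
Qed.

Lemma moment0_sech2 : moment (fun x => sech x ^+ 2) 0 = 2.
Proof.
rewrite /moment /Rintegral.
under eq_integral do rewrite expr0 mul1r.
rewrite (ge0_continuous_FTC2T _ _ is_derive_tanh cvgy_tanh cvgNy_tanh)/=.
- by rewrite opprK.
- by move=> x; rewrite sqr_ge0.
- by case: exp_decay_sech2.
Qed.
End special_functions.

(** * Closed forms of the three correlations *)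

Section correlations.
Context {R : realType}.
Local Notation mu := (@lebesgue_measure R).
Implicit Types (x s p a : R).

Lemma exp_sub_neq0 s : s != 0 -> expR s - expR (- s) != 0.
Proof.
move=> s0; apply/negP; rewrite subr_eq0 => /eqP/expR_inj h.
by move/eqP: s0; apply; lra.
Qed.

Lemma sech_half s : (sech (s / 2)) ^+ 2 = 4 * expR s / (1 + expR s) ^+ 2.
Proof.
have -> : expR s = expR (s / 2) ^+ 2 by rewrite -expRM_natl; congr expR; field.
rewrite /sech expRN; have := expR_gt0 (s / 2); set p := expR _ => p0.
by field; rewrite !gt_eqF//=; nra.
Qed.

(** In the variable [p = expR (- x)] the integral becomes that of
    [expR (- s) * p * expR (- (c * p))] over positive [p], with [c = 1 + expR (- s)]; integrating by
    parts gives [F]. *)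
Lemma correlation_gumbel s :
  (\int[mu]_x (gumbel x * gumbel (x + s))%:E = (sech (s / 2) ^+ 2 / 4)%:E)%E.
Proof.
pose c := 1 + expR (- s); have es := expR_gt0 (- s).
have c0 : 0 < c by rewrite /c; lra.
pose F x := expR (- s) * ((expR (- x) / c + c ^- 2) * expR (- (c * expR (- x)))).
have dF x : is_derive x 1 F (gumbel x * gumbel (x + s)).
  apply: is_derive_eq; rewrite /GRing.scale/= /gumbel -expRD.
  have -> : - x - expR (- x) + (- (x + s) - expR (- (x + s))) =
    - s + (- x + - x) + - (c * expR (- x)) by rewrite opprD expRD /c; ring.
  rewrite !expRD; move: (expR (- (c * _))) => E; move: (expR (- x)) => p.
  by field; rewrite gt_eqF.
rewrite (@ge0_continuous_FTC2T _ _ F (expR (- s) / c ^+ 2) 0 _ _ dF).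
- congr EFin; rewrite subr0 sech_half /c expRN; have := expR_gt0 s; set p := expR s => p0.
  by field; rewrite !gt_eqF//=; nra.
- by move=> x; rewrite mulr_ge0 ?expR_ge0.
- move=> x; apply: cvgM; first exact: continuous_gumbel.
  apply: (@continuous_comp _ _ _ (fun x => x + s)); last exact: continuous_gumbel.
  by apply: cvgD; [exact: cvg_id|exact: cvg_cst].
- pose G p := expR (- s) * ((p / c + c ^- 2) * expR (- (c * p))).
  rewrite (_ : _ / _ = G 0); last by rewrite /G mul0r add0r mulr0 oppr0 expR0 mulr1.
  apply: cvgy_comp_expRN => //.
  exact: is_derive_continuous.
- rewrite -(mulr0 (expR (- s))); apply: cvgM; first exact: cvg_cst.
  (* The exponential is split in two halves: one absorbs the linear factor [1 + c * p], the other
     tends to 0. *)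
  apply: (@squeeze_cvgr _ _ _ _ (cst 0) (fun x => 2 / c ^+ 2 * expR (- (c / 2 * expR (-
    x))))).
  + near=> x; have := expR_ge0 (- x); set p := expR (- x) => p0.
    apply/andP; split.
      by rewrite mulr_ge0 ?expR_ge0// addr_ge0// ?invr_ge0 ?exprn_ge0 ?divr_ge0// ltW.
    have -> : - (c * p) = - (c / 2 * p) + - (c / 2 * p) by field.
    rewrite expRD mulrA ler_wpM2r ?expR_ge0//.
    have : (1 + c / 2 * p) * expR (- (c / 2 * p)) <= 1.
      by rewrite expRN ler_pdivrMr ?expR_gt0// mul1r expR_ge1Dx.
    have := expR_ge0 (- (c / 2 * p)); set E := expR _ => E0 h.
    rewrite (_ : p / c + c ^- 2 = c ^- 2 * (1 + c * p)); last by field; rewrite gt_eqF.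
    rewrite (mulrC 2) -!mulrA ler_wpM2l ?invr_ge0 ?exprn_ge0 ?(ltW c0)//.
    by nra.
  + exact: cvg_cst.
  + rewrite -(mulr0 (2 / c ^+ 2)); apply: cvgM; first exact: cvg_cst.
    apply/cvgNy_compNP.
    under [X in X @ _]eq_fun do rewrite /= opprK.
    apply: (@cvg_comp _ _ _ (fun x => c / 2 * expR x) (fun y => expR (- y)) _ +oo);
      last exact: cvgr_expR.
    by apply: gt0_cvgMry; [rewrite divr_gt0|exact: cvgy_expR].
Unshelve. all: by end_near. Qed.

Lemma quad_gt0 (b c q : R) : 0 < b -> 0 <= c -> 0 < b + q ^+ 2 * c.
Proof. by move=> b0 c0; rewrite ltr_pwDl// mulr_ge0// sqr_ge0. Qed.

Lemma continuous_ln_quad (b c q : R) : 0 < b -> 0 <= c ->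
  {for q, continuous (fun q : R => ln (b + q ^+ 2 * c))}.
Proof.
move=> b0 c0; have l := quad_gt0 q b0 c0; have dl := is_derive1_ln l.
have d : is_derive q 1 (fun q : R => b + q ^+ 2 * c) (2 * q * c).
  by apply: is_derive_eq; rewrite /GRing.scale/=; ring.
exact: is_derive_continuous.
Qed.

Lemma ln_expM x p : 0 < p -> ln (expR x * p) = x + ln p.
Proof. by move=> p0; rewrite lnM ?posrE ?expR_gt0// expRK. Qed.

(** The difference [tanh (x + s) - tanh x] is the integrand times the hyperbolic sine of [s], and
    [tanh] is the derivative of the logarithm of the hyperbolic cosine. *)
Lemma correlation_sech s : s != 0 ->
  (\int[mu]_x (sech x * sech (x + s))%:E = (4 * s / (expR s - expR (- s)))%:E)%E.
Proof.
move=> s0; have sh0 := exp_sub_neq0 s0.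
have a0 : 0 < expR s := expR_gt0 s.
set a := expR s in sh0 a0 *.
have a1 : a ^+ 2 - 1 != 0.
  apply: contra_neq sh0 => h; apply: (mulfI (lt0r_neq0 a0)).
  by rewrite mulr0 mulrBr -h expr2 /a expRxMexpNx_1.
pose F x := (ln (expR (x + s) + expR (- (x + s))) - ln (expR x + expR (- x))) * (2 /
  (expR s - expR (- s))).
have dln x : is_derive x 1 (fun x => ln (expR x + expR (- x))) (tanh x).
  have d : is_derive x 1 (fun x => expR x + expR (- x)) (expR x - expR (- x)).
    by apply: is_derive_eq; rewrite mulrN1.
  have dl := is_derive1_ln (cosh2_gt0 x).
  by apply: is_derive_eq; rewrite mulrC.
have dF x : is_derive x 1 F (sech x * sech (x + s)).
  have d1 := dln x.
  have d2 : is_derive x 1 (fun x => ln (expR (x + s) + expR (- (x + s)))) (tanh (x + s)).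
    have d3 := dln (x + s).
    have d4 : is_derive x 1 (fun x => x + s) 1 by apply: is_derive_eq; rewrite addr0.
    by have := @is_derive1_comp _ _ (fun x => x + s) _ _ _ d3 d4; rewrite mulr1.
  apply: is_derive_eq; rewrite /GRing.scale/= /tanh /sech opprD !expRD !expRN.
  have n1 (y : R) : y * y + 1 != 0 by rewrite gt_eqF// ltr_wpDl// -expr2 sqr_ge0.
  by field; rewrite !n1 !expR_eq0 -expr2 a1.
rewrite (@ge0_continuous_FTC2T _ _ F (s * (2 / (expR s - expR (- s)))) (- s * (2 / (expR
  s - expR (- s)))) _ _ dF).
- by congr EFin; rewrite -/a; field.
- by move=> x; rewrite mulr_ge0 ?(ltW (sech_gt0 _)).
- move=> x; apply: cvgM; first exact: continuous_sech.
  apply: (@continuous_comp _ _ _ (fun x => x + s)); last exact: continuous_sech.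
  by apply: cvgD; [exact: cvg_id|exact: cvg_cst].
- apply: cvgM; last exact: cvg_cst.
  have sE : s = ln (a + 0 ^+ 2 * a^-1) - ln (1 + 0 ^+ 2 * 1).
    by rewrite expr0n !mul0r !addr0 ln1 subr0 expRK.
  rewrite [X in _ --> X]sE.
  apply: (cvgy_comp_expRN (G := fun q => ln (a + q ^+ 2 * a^-1) - ln (1 + q ^+ 2 * 1))).
    by apply: cvgB; apply: continuous_ln_quad => //; rewrite invr_ge0 ltW.
  move=> x; rewrite opprD !expRD.
  have -> : expR x * expR s + expR (- x) * expR (- s) = expR x * (a + expR (- x) ^+ 2 *
    a^-1).
    by rewrite !expRN -/a; field; rewrite ?expR_eq0 ?gt_eqF.
  have -> : expR x + expR (- x) = expR x * (1 + expR (- x) ^+ 2 * 1).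
    by rewrite !expRN; field; rewrite expR_eq0.
  by rewrite !ln_expM ?quad_gt0//; [ring|rewrite invr_ge0 ltW].
- apply: cvgM; last exact: cvg_cst.
  have -> : - s = ln (a^-1 + 0 ^+ 2 * a) - ln (1 + 0 ^+ 2 * 1).
    by rewrite expr0n !mul0r !addr0 ln1 subr0 -expRN expRK.
  have ai : 0 < a^-1 by rewrite invr_gt0.
  apply: (cvgNy_comp_expR (G := fun q => ln (a^-1 + q ^+ 2 * a) - ln (1 + q ^+ 2 * 1))).
    by apply: cvgB; apply: continuous_ln_quad => //; rewrite ltW.
  move=> x; rewrite opprD !expRD.
  have -> : expR x * expR s + expR (- x) * expR (- s) = expR (- x) * (a^-1 + expR x ^+ 2
    * a).
    by rewrite !expRN -/a; field; rewrite ?expR_eq0 ?gt_eqF.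
  have -> : expR x + expR (- x) = expR (- x) * (1 + expR x ^+ 2 * 1).
    by rewrite !expRN; field; rewrite expR_eq0.
  by rewrite !ln_expM ?quad_gt0//; [ring|rewrite ltW].
Qed.

(* [G] is a primitive of the integrand in the variable [p = e^x], obtained by
   partial fractions with [a = e^(-s)]; it degenerates at [a = 1]. *)
Lemma correlation_sech2 s : s != 0 ->
  (\int[mu]_x (sech x ^+ 2 * sech (x + s))%:E = (pi / 2 * sech (s / 2) ^+ 2)%:E)%E.
Proof.
move=> s0; have es0 : expR (- s) != 1.
  by apply/eqP => /(congr1 (@ln R)); rewrite expRK ln1; apply/eqP; rewrite oppr_eq0.
have a0 : 0 < expR (- s) := expR_gt0 (- s).
set a := expR (- s) in es0 a0.
have D0 : a ^+ 2 - 1 != 0.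
  by rewrite subr_sqr_1 mulf_neq0// ?subr_eq0// gt_eqF// addr_gt0.
pose D := a ^+ 2 - 1.
pose G p := 8 * a * (a ^+ 2 / D ^+ 2 * atan p - (atan p + p * (1 + p ^+ 2)^-1) / 2 / D
   - a / D ^+ 2 * atan (p / a)).
have q0 (p : R) : 1 + p ^+ 2 != 0 by rewrite gt_eqF// ltr_pwDl// sqr_ge0.
have dG p : is_derive p 1 G (8 * a * p ^+ 2 / ((1 + p ^+ 2) ^+ 2 * (a ^+ 2 + p ^+ 2))).
  have d0 : is_derive p 1 (fun p => 1 + p ^+ 2) (2 * p).
    by apply: is_derive_eq; rewrite /GRing.scale/=; ring.
  have d1 := @is_deriveV _ (fun p => 1 + p ^+ 2) _ _ _ (q0 p) d0.
  apply: is_derive_eq; rewrite /GRing.scale/= /D.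
  have n1 (y : R) : 1 + y * y != 0 by rewrite -expr2.
  have n2 (y : R) : a * a + y * y != 0 by rewrite gt_eqF// ltr_pwDl// ?mulr_gt0// -expr2
    sqr_ge0.
  have n3 (y : R) : y * y + a * a != 0 by rewrite addrC.
  have n4 (y : R) : y * y + 1 != 0 by rewrite addrC.
  by field; rewrite ?n1 ?n2 ?n3 ?n4 -?expr2 ?D0 (gt_eqF a0).
have dF x : is_derive x 1 (fun x => G (expR x)) (sech x ^+ 2 * sech (x + s)).
  have dGx := dG (expR x).
  have dc := is_derive1_comp dGx (is_derive_expR x).
  apply: (is_derive_eq dc); rewrite /sech opprD !expRD -/a.
  have -> : expR s = a^-1 by rewrite /a expRN invrK.
  rewrite expRN; have := expR_gt0 x; set p := expR x => p0.
  by field; rewrite !gt_eqF//=; nra.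
(* At infinity the bracket in [G] tends to [pi / 2 * (a - 1) ^+ 2 / (2 * D ^+ 2)], so the
   singularity at [a = 1] cancels and [2 * pi * a / (a + 1) ^+ 2] remains. *)
rewrite (@ge0_continuous_FTC2T _ _ (fun x => G (expR x))
  (8 * a * (a ^+ 2 / D ^+ 2 * (pi / 2) - (pi / 2 + 0) / 2 / D - a / D ^+ 2 * (pi / 2))) 0
    _ _ dF).
- congr EFin; rewrite sech_half /D.
  have -> : expR s = a^-1 by rewrite /a expRN invrK.
  by field; rewrite -?expr2 D0 !gt_eqF//=; nra.
- by move=> x; rewrite mulr_ge0 ?sqr_ge0 ?(ltW (sech_gt0 _)).
- move=> x; apply: cvgM; first by apply: cvgM; exact: continuous_sech.
  apply: (@continuous_comp _ _ _ (fun x => x + s)); last exact: continuous_sech.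
  by apply: cvgD; [exact: cvg_id|exact: cvg_cst].
- have at1 : atan (expR x) @[x --> +oo%R] --> (pi / 2 : R).
    exact: (cvg_comp _ _ cvgy_expR (@cvgy_atan R)).
  have ata : atan (expR x / a) @[x --> +oo%R] --> (pi / 2 : R).
    apply: (cvg_comp (fun x => expR x / a) _ _ (@cvgy_atan R)).
    by apply: gt0_cvgMly; [rewrite invr_gt0|exact: cvgy_expR].
  apply: cvgM; first exact: cvg_cst.
  apply: cvgB; last by apply: cvgM; [exact: cvg_cst|exact: ata].
  apply: cvgB; first by apply: cvgM; [exact: cvg_cst|exact: at1].
  apply: cvgM; last exact: cvg_cst.
  apply: cvgM; last exact: cvg_cst.
  apply: cvgD; first exact: at1.
  rewrite [X in _ --> X](_ : 0 = 0 * (1 + 0 ^+ 2)^-1); last by rewrite mul0r.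
  apply: (cvgy_comp_expRN (G := fun q => q * (1 + q ^+ 2)^-1)).
    apply: cvgM; first exact: cvg_id.
    by apply: cvgV => //; apply: cvgD; [exact: cvg_cst|exact: exprn_continuous].
  move=> x; rewrite expRN; have := expR_gt0 x; set p := expR x => p0.
  by field; rewrite !gt_eqF//=; nra.
- rewrite [X in _ --> X](_ : 0 = G 0); last by rewrite /G !mul0r atan0; ring.
  by apply: cvgNy_comp_expR => //; apply: (is_derive_continuous (dG 0)).
Qed.
End correlations.

(** * Linear changes of variable *)

Section scale.
Context {R : realType}.
Local Notation mu := (@lebesgue_measure R).

Lemma preimage_mul_itv (r a b : R) : r != 0 -> a <= b ->
  mu ( *%R r @^-1` `]a, b]) = ((b - a) / `|r|)%:E.
Proof.
move=> r0 ab; have [rlt|rgt|req] := ltgtP r 0; last by rewrite req eqxx in r0.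
- rewrite (_ : _ @^-1` _ = `[b / r, a / r[%classic); last first.
    by apply/seteqP; split => x /=;
      rewrite !in_itv/= ler_ndivrMr// ltr_ndivlMr// (mulrC x) andbC.
  rewrite lebesgue_measure_itv/= lte_fin ltr_nM2r ?invr_lt0// ltr0_norm//.
  by case: ltgtP ab => // [ab _|->_]; rewrite ?subrr ?mul0r// -EFinB; congr EFin; field.
- rewrite (_ : _ @^-1` _ = `]a / r, b / r]%classic); last first.
    by apply/seteqP; split => x /=; rewrite !in_itv/= ltr_pdivrMr// ler_pdivlMr// (mulrC x).
  rewrite lebesgue_measure_itv/= lte_fin ltr_pM2r ?invr_gt0// gtr0_norm//.
  by case: ltgtP ab => // [ab _|->_]; rewrite ?subrr ?mul0r// -EFinB; congr EFin; field.
Qed.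

(** Lebesgue measure is determined by half-open intervals, on which it agrees with [|r|] times its
    image under multiplication by [r]. Negative [r] is included, which covers reflections. *)
Lemma integral_scale (r : R) (D : set R) (f : R -> \bar R) : r != 0 ->
  measurable D -> measurable_fun D f -> (forall x, D x -> (0 <= f x)%E) ->
  (\int[mu]_(x in D) f x =
   `|r|%:E * \int[mu]_(x in *%R r @^-1` D) f (r * x)%R)%E.
Proof.
move=> r0 mD mf f0.
have mr : measurable_fun setT ( *%R r : measurableTypeR R -> measurableTypeR R).
  by apply: continuous_measurable_fun => x; exact: mulrl_continuous.
pose mphi := isMeasurableFun.Build _ _ _ _ _ mr.
pose phi : {mfun (measurableTypeR R) >-> (measurableTypeR R)} := HB.pack ( *%R r : R ->
  R) mphi.
pose rn : {nonneg R} := NngNum (normr_ge0 r).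
rewrite (eq_measure_integral (mscale rn (pushforward mu phi))); last first.
  move=> A mA _; apply: lebesgue_measure_unique => // X /ocitvP[->|[[a b]/= ab ->]].
    by rewrite !measure0.
  rewrite /mscale/= /pushforward preimage_mul_itv//; last exact: ltW.
  rewrite lebesgue_measure_itv/= lte_fin ab -EFinD -EFinM; congr EFin.
  by field; rewrite normr_eq0.
rewrite ge0_integral_mscale//.
rewrite ge0_integral_pushforward// => x; rewrite inE; exact: f0.
Qed.
End scale.

(** * Reduction to the half-line, and integration by parts there *)

Section halfline.
Context {R : realType}.
Local Notation mu := (@lebesgue_measure R).
Implicit Types (f F : R -> R).

Lemma integralT_even f : (forall x, 0 <= f x) -> measurable_fun setT f ->
  (forall x, f (- x) = f x) ->
  (\int[mu]_x (f x)%:E = 2%:E * \int[mu]_(x in `]0%R, +oo[) (f x)%:E)%E.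
Proof.
move=> f0 mf fN; rewrite -(setUv `[0%R, +oo[%classic) ge0_integral_setU//=; last 4 first.
- exact: measurableC.
- by apply/measurable_EFinP; rewrite setUv.
- by move=> x _; rewrite lee_fin.
- exact/disj_setPCl.
rewrite -integral_itv_obnd_cbnd; last exact/measurable_EFinP/measurable_funTS.
rewrite mule_natl mule2n; congr (_ + _)%E.
rewrite (@integral_scale _ (-1))//; last 3 first.
- exact: measurableC.
- exact/measurable_EFinP/measurable_funTS.
- by move=> x _; rewrite lee_fin.
rewrite normrN1 mul1e setCitvr (_ : _ @^-1` _ = `]0%R, +oo[%classic); last first.
  by apply/seteqP; split => x /=; rewrite !in_itv/= mulN1r ?andbT oppr_lt0.
by apply: eq_integral => x _; rewrite mulN1r fN.
Qed.

(** Integration by parts without knowing either integral to be finite: on [[0, n]] they differ by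
    [F n], which tends to 0, and both converge monotonically in the extended reals. *)
Lemma FTC2y_sub f1 f2 F : continuous f1 -> continuous f2 ->
  (forall x, 0 <= x -> 0 <= f1 x) -> (forall x, 0 <= x -> 0 <= f2 x) ->
  (forall x : R, is_derive x 1 F (f1 x - f2 x)) -> F 0 = 0 ->
  F x @[x --> +oo] --> (0 : R) ->
  (\int[mu]_(x in `[0%R, +oo[) (f1 x)%:E = \int[mu]_(x in `[0%R, +oo[) (f2 x)%:E)%E.
Proof.
move=> c1 c2 p1 p2 dF F0 Fy.
have lim f : continuous f -> (forall x, 0 <= x -> 0 <= f x) ->
    (\int[mu]_(x in `[0%R, n%:R]) (f x)%:E @[n --> \oo] -->
     \int[mu]_(x in `[0%R, +oo[) (f x)%:E)%E.
  move=> cf f0.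
  have m : measurable_fun setT (fun x => `|f x|).
    by apply: measurableT_comp => //; exact: continuous_measurable_fun.
  have nE : (\int[mu]_(x in `[0%R, +oo[) `|f x|%:E = \int[mu]_(x in `[0%R, +oo[) (f
    x)%:E)%E.
    by apply: eq_integral => x; rewrite inE/= in_itv/= andbT => x0; rewrite ger0_norm// f0.
  have := @ge0_cvgn_integral _ mu _ (fun x => normr_ge0 (f x)) m; rewrite nE.
  apply: cvg_trans; apply: near_eq_cvg; near=> n.
  by apply: eq_integral => x; rewrite inE/= in_itv/= => /andP[x0 _]; rewrite ger0_norm// f0.
have step n : (\int[mu]_(x in `[0%R, n%:R]) (f1 x)%:E =
    \int[mu]_(x in `[0%R, n%:R]) (f2 x)%:E + (F n%:R)%:E)%E.
  have ci f : continuous f -> mu.-integrable `[0%R, n%:R] (EFin \o f).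
    move=> cf; apply: continuous_compact_integrable; first exact: segment_compact.
    exact: continuous_subspaceT.
  have [->|n0] := eqVneq n 0%N.
    by rewrite set_itv1 !integral_set1 F0 adde0.
  have n0' : (0 : R) < n%:R by rewrite ltr0n lt0n.
  have := @continuous_FTC2 _ (fun x => f1 x - f2 x) F 0 n%:R n0'.
  rewrite F0 sube0 => <-.
  - under [X in (_ + X)%E]eq_integral do rewrite EFinB.
    rewrite integralB_EFin//; [|exact: ci|exact: ci].
    by rewrite addeC subeK//; apply: integrable_fin_num => //; exact: ci.
  - by apply: continuous_subspaceT => x; apply: cvgB; [exact: c1|exact: c2].
  - have cF x : {for x, continuous F} by exact: is_derive_continuous (dF x).
    split; first by move=> x _; case: (dF x).
      by apply: cvg_at_right_filter; exact: cF.
    by apply: cvg_at_left_filter; exact: cF.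
  - by move=> x _; rewrite derive1E; case: (dF x).
have Fn : (F n%:R)%:E @[n --> \oo] --> (0%:E : \bar R).
  by apply: cvg_EFin; [exact: nearW|]; exact: (cvg_comp _ _ (@cvgr_idn R) Fy).
have h1 := lim _ c1 p1; have h2 := lim _ c2 p2.
have : (\int[mu]_(x in `[0%R, n%:R]) (f2 x)%:E + (F n%:R)%:E @[n --> \oo] -->
     \int[mu]_(x in `[0%R, +oo[) (f2 x)%:E + 0)%E.
  by apply: cvgeD => //; rewrite fin_num_adde_defl.
under [X in X @ _ --> _]eq_fun do rewrite -step.
by rewrite adde0 => h3; apply: (cvg_unique _ h1 h3).
Unshelve. all: by end_near. Qed.

End halfline.

(** * Bose and Fermi integrals *)

Section bose_fermi.
Context {R : realType}.
Local Notation mu := (@lebesgue_measure R).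
Implicit Types (x : R) (m n : nat).

Lemma measurable_invr : measurable_fun setT (fun x : R => x^-1).
Proof.
rewrite -(setvU [set (0 : R)]); apply/measurable_funU => //; first exact: measurableC.
split; last exact: measurable_fun_set1.
apply: open_continuous_measurable_fun; first by rewrite openC; exact: closed_eq.
move=> x; rewrite inE/= => /eqP x0; exact: inv_continuous.
Qed.

Local Notation D := (`]0%R, +oo[%classic : set R).

(** Extended-real valued, since finiteness is deduced only in [moment_sech2_succ]; the open
    half-line avoids the zero of the denominator. *)
Definition bose m : \bar R := (\int[mu]_(x in D) (x ^+ m / (expR x - 1))%:E)%E.
Definition fermi m : \bar R := (\int[mu]_(x in D) (x ^+ m / (expR x + 1))%:E)%E.

Lemma itv0y_gt0 x : D x -> 0 < x. Proof. by rewrite /= in_itv/= andbT. Qed.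

Lemma preimage_double_itv0y : *%R (2 : R) @^-1` D = D.
Proof. by apply/seteqP; split => x /=; rewrite !in_itv/= !andbT pmulr_rgt0. Qed.

Lemma expR_sub1_gt0 x : 0 < x -> 0 < expR x - 1.
Proof. by move=> x0; rewrite subr_gt0 expR_gt1. Qed.

Lemma expR_add1_gt0 x : 0 < expR x + 1.
Proof. by rewrite addr_gt0 ?expR_gt0. Qed.

Lemma measurable_pow_div m (g : R -> R) : measurable_fun setT g ->
  measurable_fun setT (fun x : R => x ^+ m / g x).
Proof.
move=> mg; apply: measurable_funM; first exact: measurable_funX.
exact: (measurableT_comp measurable_invr).
Qed.

Lemma exprN_double x n : (- x) ^+ n.*2 = x ^+ n.*2.
Proof. by rewrite -mul2n !exprM sqrrN. Qed.

Lemma measurable_expRD (e : R) : measurable_fun setT (fun x => expR x + e).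
Proof. exact: measurable_funD. Qed.

Lemma integral_double m (e : R) (g := fun x : R => x ^+ m / (expR x + e)) :
  (forall x, 0 < x -> 0 < expR x + e) ->
  (\int[mu]_(x in D) (2 * x ^+ m / (expR (2 * x) + e))%:E =
   (2 ^- m)%:E * \int[mu]_(x in D) (g x)%:E)%E.
Proof.
move=> ge; have mg : measurable_fun setT g.
  by apply: measurable_pow_div; exact: measurable_funD.
rewrite (@integral_scale _ 2 D (fun x => (g x)%:E))//; last 2 first.
- exact/measurable_EFinP/measurable_funTS.
- by move=> x /itv0y_gt0 x0; rewrite lee_fin divr_ge0 ?exprn_ge0 ?ltW// ge.
rewrite preimage_double_itv0y muleA -EFinM -ge0_integralZl//.
- apply: eq_integral => x _; rewrite -EFinM; congr EFin.
  by rewrite /g exprMn ger0_norm//; move: (_ + e)^-1 => I; field.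
- apply/measurable_EFinP/measurable_funTS.
  by apply: (measurableT_comp mg); exact: measurable_funM.
- move=> x /itv0y_gt0 x0; rewrite lee_fin divr_ge0 ?exprn_ge0 ?mulr_ge0 ?ltW// ge//.
  by rewrite mulr_gt0.
Qed.

(* [1/(e^x-1) = 1/(e^x+1) + 2/(e^(2x)-1)]. *)
Lemma bose_eq m : bose m = (fermi m + (2 ^- m)%:E * bose m)%E.
Proof.
rewrite -(integral_double m (e := -1) expR_sub1_gt0) -ge0_integralD//.
- apply: eq_integral => x; rewrite inE => /itv0y_gt0 x0; rewrite -EFinD; congr EFin.
  rewrite (_ : 2 * x = x + x) ?expRD; last by ring.
  have := expR_sub1_gt0 x0; have := expR_gt0 x; set p := expR x => p0 p1.
  by field; rewrite !gt_eqF//=; nra.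
- by move=> x /itv0y_gt0 x0; rewrite lee_fin divr_ge0 ?exprn_ge0 ?ltW// expR_add1_gt0.
- by apply/measurable_EFinP/measurable_funTS; apply: measurable_pow_div;
    exact: measurable_expRD.
- by move=> x /itv0y_gt0 x0;
    rewrite lee_fin divr_ge0 ?mulr_ge0 ?exprn_ge0 ?ltW// expR_sub1_gt0// mulr_gt0.
- apply/measurable_EFinP/measurable_funTS.
  apply: measurable_funM; first by apply: measurable_funM => //; exact: measurable_funX.
  apply: (measurableT_comp measurable_invr); apply: measurable_funD => //.
  by apply: measurableT_comp => //; exact: measurable_funM.
Qed.

Lemma measurable_sinhV : measurable_fun setT (fun x : R => (expR x - expR (- x))^-1).
Proof.
apply: (measurableT_comp measurable_invr); apply: measurable_funB => //.
by apply: measurableT_comp.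
Qed.

(** By partial fractions [2 / (expR x - expR (- x))] is [(expR x - 1)^-1 + (expR x + 1)^-1];
    evenness supplies a further factor 2. *)
Lemma moment_csch n : (\int[mu]_x (x ^+ n.*2 * (4 * x / (expR x - expR (- x))))%:E =
  4%:E * (bose n.*2.+1 + fermi n.*2.+1))%E.
Proof.
have p0 (x : R) : 0 <= 4 * x / (expR x - expR (- x)).
  have [x0|x0|->] := ltgtP x 0; last by rewrite mulr0 mul0r.
  - rewrite -mulrNN -invrN opprB -mulrN divr_ge0//;
      first by rewrite mulr_ge0// oppr_ge0 ltW.
    by rewrite subr_ge0 ler_expR; lra.
  - by rewrite divr_ge0// ?mulr_ge0// ?ltW// subr_gt0 ltr_expR; lra.
rewrite integralT_even; last 3 first.
- by move=> x; rewrite mulr_ge0// exprn_even_ge0// odd_double.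
- apply: measurable_funM; first exact: measurable_funX.
  by apply: measurable_funM; [exact: measurable_funM|exact: measurable_sinhV].
- move=> x; rewrite exprN_double; congr (_ * _).
  by rewrite opprK mulrN mulNr -mulrN -invrN opprB.
rewrite (_ : 4%:E = (2%:E * 2%:E)%E) -?muleA; last by rewrite -EFinM -natrM.
congr (_ * _)%E; rewrite -ge0_integralD//; last 4 first.
- by move=> x /itv0y_gt0 x0; rewrite lee_fin divr_ge0 ?exprn_ge0 ?ltW// expR_sub1_gt0.
- by apply/measurable_EFinP/measurable_funTS; apply: measurable_pow_div;
    exact: measurable_expRD.
- by move=> x /itv0y_gt0 x0; rewrite lee_fin divr_ge0 ?exprn_ge0 ?ltW// expR_add1_gt0.
- by apply/measurable_EFinP/measurable_funTS; apply: measurable_pow_div;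
    exact: measurable_expRD.
rewrite -ge0_integralZl//.
- apply: eq_integral => x; rewrite inE => /itv0y_gt0 x0; rewrite -EFinD -EFinM; congr EFin.
  rewrite exprS expRN; have := expR_sub1_gt0 x0; have := expR_gt0 x;
    set p := expR x => p1 p2.
  by field; rewrite !gt_eqF//=; nra.
- by apply: emeasurable_funD; apply/measurable_EFinP/measurable_funTS;
    apply: measurable_pow_div; exact: measurable_expRD.
- move=> x /itv0y_gt0 x0;
    rewrite lee_fin addr_ge0// divr_ge0 ?exprn_ge0 ?ltW// ?expR_sub1_gt0// expR_add1_gt0.
Qed.

Lemma is_derive_pow k x : is_derive x 1 (fun x : R => x ^+ k) (k%:R * x ^+ k.-1).
Proof.
have := @is_deriveX _ _ id k x 1 1 (is_derive_id _ _); rewrite /GRing.scale/= mulr1.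
by rewrite (_ : id ^+ k = fun x => x ^+ k)//; apply/funext => y; rewrite fctE.
Qed.

(* Integration by parts against [1 - tanh x = 2/(e^(2x)+1)]. *)
Lemma moment_sech2_fermi n :
  (\int[mu]_x (x ^+ n.+1.*2 * sech x ^+ 2)%:E =
   (2 * n.+1.*2%:R * 2 ^- n.*2.+1)%:E * fermi n.*2.+1)%E.
Proof.
have cs : continuous (fun x : R => x ^+ n.+1.*2 * sech x ^+ 2).
  by move=> x; apply: cvgM; [exact: exprn_continuous|apply: cvgM; exact: continuous_sech].
rewrite integralT_even; last 3 first.
- by move=> x; rewrite mulr_ge0 ?sqr_ge0// exprn_even_ge0// odd_double.
- exact: continuous_measurable_fun.
- by move=> x; rewrite sechN exprN_double.
rewrite -mulrA EFinM -muleA; congr (_ * _)%E.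
rewrite EFinM -muleA -(integral_double _ (e := 1)); last by move=> x _;
  exact: expR_add1_gt0.
have ct : continuous (fun x : R => n.+1.*2%:R * x ^+ n.*2.+1 * (1 - tanh x)).
  move=> x; apply: cvgM; first by apply: cvgM; [exact: cvg_cst|exact: exprn_continuous].
  by apply: cvgB; [exact: cvg_cst|exact: (is_derive_continuous (is_derive_tanh x))].
have tE x : 1 - tanh x = 2 / (expR (2 * x) + 1).
  rewrite (_ : 2 * x = x + x) ?expRD /tanh ?expRN; last by ring.
  have := expR_gt0 x; set p := expR x => p0.
  by field; rewrite !gt_eqF//=; nra.
transitivity (\int[mu]_(x in D) (n.+1.*2%:R * x ^+ n.*2.+1 * (1 - tanh x))%:E)%E;
  last first.
  rewrite -ge0_integralZl//.
  - by apply: eq_integral => x _; rewrite tE -EFinM; congr EFin; ring.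
  - apply/measurable_EFinP/measurable_funTS.
    apply: measurable_funM; first by apply: measurable_funM => //; exact: measurable_funX.
    apply: (measurableT_comp measurable_invr); apply: measurable_funD => //.
    by apply: measurableT_comp => //; exact: measurable_funM.
  - by move=> x /itv0y_gt0 x0;
      rewrite lee_fin divr_ge0 ?mulr_ge0 ?exprn_ge0 ?ltW// expR_add1_gt0.
rewrite [LHS]integral_itv_obnd_cbnd; last first.
  by apply/measurable_EFinP/measurable_funTS; exact: continuous_measurable_fun.
rewrite [RHS]integral_itv_obnd_cbnd; last first.
  by apply/measurable_EFinP/measurable_funTS; exact: continuous_measurable_fun.
apply/esym/(@FTC2y_sub _ _ _ (fun x => x ^+ n.+1.*2 * (1 - tanh x))) => //.
- by move=> x x0; rewrite tE !mulr_ge0 ?exprn_ge0// invr_ge0 ltW// expR_add1_gt0.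
- by move=> x x0; rewrite mulr_ge0 ?sqr_ge0// exprn_ge0.
- move=> x; have dt := is_derive_tanh x; have dX := is_derive_pow n.+1.*2 x.
  by apply: is_derive_eq; rewrite /GRing.scale/= !doubleS; ring.
- by rewrite expr0n mul0r.
- apply: (@squeeze_cvgr _ _ _ _ (cst 0) (fun x => 2 * n.+1.*2`!%:R * expR (- x))).
  + near=> x; have x0 : 0 <= x by near: x; apply: nbhs_pinfty_ge; exact: num_real.
    rewrite tE; have := expR_add1_gt0 (2 * x); have e0 := expR_gt0 x => e1.
    apply/andP; split; first by rewrite mulr_ge0 ?exprn_ge0// divr_ge0// ltW.
    have := pow_le_expR x n.+1.*2; rewrite ger0_norm// => h.
    rewrite mulrA ler_pdivrMr//.
    rewrite (@le_trans _ _ (n.+1.*2`!%:R * expR x * 2))// ?ler_wpM2r//.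
    have -> : 2 * n.+1.*2`!%:R * expR (- x) * (expR (2 * x) + 1) =
        n.+1.*2`!%:R * expR x * 2 + 2 * n.+1.*2`!%:R * expR (- x).
      rewrite (_ : 2 * x = x + x) ?expRD ?expRN; last by ring.
      by field; rewrite gt_eqF.
    by rewrite lerDl !mulr_ge0// expR_ge0.
  + exact: cvg_cst.
  + rewrite -(mulr0 (2 * n.+1.*2`!%:R)); apply: cvgM; [exact: cvg_cst|exact: cvgr_expR].
Unshelve. all: by end_near. Qed.

End bose_fermi.

(** * Even moments as rational multiples of powers of pi *)

Section rational_multiples.
Context {R : realType}.
Local Notation mu := (@lebesgue_measure R).
Implicit Types (x y : R) (d k n : nat).

(** Zero qualifies in every degree, which accommodates the vanishing odd moments. *)
Definition rat_pi_pow d x := exists q : rat, x = ratr q * pi ^+ d.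

Lemma rat_pi_pow0 d : rat_pi_pow d 0.
Proof. by exists 0; rewrite rmorph0 mul0r. Qed.

Lemma rat_pi_powD d x y : rat_pi_pow d x -> rat_pi_pow d y -> rat_pi_pow d (x + y).
Proof. by move=> [p ->] [q ->]; exists (p + q); rewrite rmorphD mulrDl. Qed.

Lemma rat_pi_powM d d' x y :
  rat_pi_pow d x -> rat_pi_pow d' y -> rat_pi_pow (d + d') (x * y).
Proof. by move=> [p ->] [q ->]; exists (p * q); rewrite rmorphM exprD mulrACA. Qed.

Lemma rat_pi_powZ (q : rat) d x : rat_pi_pow d x -> rat_pi_pow d (ratr q * x).
Proof. by move=> [p ->]; exists (q * p); rewrite rmorphM mulrA. Qed.

Lemma rat_pi_pow_sum d m (F : 'I_m -> R) :
  (forall i, rat_pi_pow d (F i)) -> rat_pi_pow d (\sum_i F i).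
Proof.
by move=> h; elim/big_ind: _ => // [|x y]; [exact: rat_pi_pow0|exact: rat_pi_powD].
Qed.

Lemma integral_moment f n : exp_decay f ->
  (\int[mu]_x (x ^+ n * f x)%:E = (moment f n)%:E)%E.
Proof.
move=> df; rewrite /moment /Rintegral fineK//.
by apply: integrable_fin_num => //; exact: integrable_moment.
Qed.

Lemma moment_odd f k : exp_decay f -> (forall x, f (- x) = f x) -> odd k ->
  moment f k = 0.
Proof.
move=> df fN ko; have ik := integrable_moment k df.
pose phi x := x ^+ k * f x.
have phiN x : phi (- x) = - phi x by rewrite /phi fN exprNn -signr_odd ko mulN1r mulNr.
have ia : mu.-integrable setT (EFin \o (fun x => `|phi x|)) by exact: (integrable_abse ik).
have mp : measurable_fun setT phi.
  by apply: continuous_measurable_fun => x; case: df => cf _ _; apply: cvgM;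
    [exact: exprn_continuous|exact: cf].
(* The change of variable is available for nonnegative integrands, so oddness is applied to
   [|phi| + phi] and [|phi| - phi], which the reflection exchanges. *)
have : (\int[mu]_x (`|phi x| + phi x)%:E = \int[mu]_x (`|phi x| - phi x)%:E)%E.
  rewrite (@integral_scale _ (-1) setT)//.
  - rewrite normrN1 mul1e preimage_setT; apply: eq_integral => x _.
    by rewrite mulN1r phiN normrN.
  - by apply/measurable_EFinP; apply: measurable_funD => //; exact: measurableT_comp.
  - by move=> x _; rewrite lee_fin; have := ler_norm (- phi x); rewrite normrN; lra.
under eq_integral do rewrite EFinD.
under [RHS]eq_integral do rewrite EFinB.
rewrite integralD//= integralB_EFin//=.
have := integrable_fin_num measurableT ik; have := integrable_fin_num measurableT ia.
rewrite /moment /Rintegral -/phi => /fineK <- /fineK <-.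
rewrite -EFinD -EFinB => -[]/=; lra.
Qed.

Lemma measurable_sech : measurable_fun setT (@sech R).
Proof. by apply: continuous_measurable_fun; exact: continuous_sech. Qed.

Lemma moment_half (c : R) n : 0 <= c ->
  (\int[mu]_s (s ^+ n.*2 * (c * sech (s / 2) ^+ 2))%:E =
   (c * 2 ^+ n.*2.+1 * moment (fun x => sech x ^+ 2) n.*2)%:E)%E.
Proof.
move=> c0; rewrite (@integral_scale _ 2 setT)//; last 2 first.
- apply/measurable_EFinP; apply: measurable_funM; first exact: measurable_funX.
  apply: measurable_funM => //; apply: measurable_funX.
  by apply: (measurableT_comp measurable_sech); exact: measurable_funM.
- by move=> x _; rewrite lee_fin !mulr_ge0 ?sqr_ge0// exprn_even_ge0// odd_double.
rewrite preimage_setT EFinM -integral_moment; last exact: exp_decay_sech2.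
rewrite ger0_norm// -!ge0_integralZl//.
- apply: eq_integral => x _; rewrite -!EFinM exprMn (mulrC 2 x) mulfK//.
  by rewrite (exprS 2); congr EFin; ring.
- apply/measurable_EFinP; apply: measurable_funM; first exact: measurable_funX.
  by apply: measurable_funX; exact: measurable_sech.
- by move=> x _; rewrite lee_fin mulr_ge0 ?sqr_ge0// exprn_even_ge0// odd_double.
- by rewrite lee_fin mulr_ge0// exprn_ge0.
- apply/measurable_EFinP; apply: measurable_funM; first by apply: measurable_funX;
    exact: measurable_funM.
  apply: measurable_funM => //; apply: measurable_funX.
  apply: (measurableT_comp measurable_sech); apply: measurable_funM => //.
- by move=> x _; rewrite lee_fin !mulr_ge0 ?sqr_ge0// exprn_even_ge0// odd_double.
Qed.

Definition sech2 x : R := sech x ^+ 2.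

(** Both sides are positive rational multiples of one Bose integral: with [t = 2 ^- n.*2.+1],
    [bose_eq] turns [fermi] into [(1 - t) * bose], so [bose + fermi] is [(2 - t) * bose]. *)
Lemma moment_sech2_succ n : exists2 q : rat, 0 < q &
  moment sech2 n.+1.*2 = ratr q * \sum_(k < n.*2.+1) (-1) ^+ k * 'C(n.*2, k)%:R *
    moment (@sech R) k * moment (@sech R) (n.*2 - k).
Proof.
set S := \sum_(k < _) _.
have : (4%:E * (bose n.*2.+1 + fermi n.*2.+1) = S%:E)%E.
  rewrite -moment_csch; apply: correlation_moment; [exact: exp_decay_sech..| |].
    by apply: measurable_funM; [exact: measurable_funM|exact: measurable_sinhV].
  by move=> s s0; rewrite correlation_sech.
have := integral_moment n.+1.*2 (exp_decay_sech2 (R := R));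
  rewrite moment_sech2_fermi -/sech2.
have := @bose_eq R n.*2.+1.
have b0 : (0 <= @bose R n.*2.+1)%E.
  apply: integral_ge0 => x /itv0y_gt0 x0.
  by rewrite lee_fin divr_ge0 ?exprn_ge0 ?ltW// expR_sub1_gt0.
have f0 : (0 <= @fermi R n.*2.+1)%E.
  apply: integral_ge0 => x /itv0y_gt0 x0.
  by rewrite lee_fin divr_ge0 ?exprn_ge0 ?ltW// expR_add1_gt0.
(* An infinite value on the left would contradict the finite sum [S]. *)
case: (bose _) b0 => [b| |] b0 //; last first.
  by rewrite addye ?gt0_muley ?lte_fin//; case: (fermi _) f0.
case: (fermi _) f0 => [f| |] f0 //.
rewrite -!EFinD -!EFinM => -[bE] [<-] [SE].
pose t : rat := 2 ^- n.*2.+1.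
have tE : 2 ^- n.*2.+1 = ratr t :> R by rewrite /t fmorphV rmorphXn/= ratr_nat.
have t01 : 0 < t < 1.
  by rewrite invr_gt0 exprn_gt0//= invf_lt1 ?exprn_gt0// exprn_egt1.
have /andP[t0 t1] := t01.
exists (2 * n.+1.*2%:R * t * (1 - t) / (4 * (2 - t))).
  by rewrite divr_gt0 ?mulr_gt0 ?ltr0n//; lra.
have tR1 : ratr t < 1 :> R by rewrite -(rmorph1 (ratr : rat -> R)) ltr_rat.
rewrite -SE tE fmorph_div !rmorphM !rmorphB/= !ratr_nat rmorph1.
move: bE; rewrite tE => bE; have -> : f = (1 - ratr t) * b by lra.
by field; rewrite gt_eqF//; lra.
Qed.

(** The term [k = 0] is [2 * moment sech n.*2] and the others involve lower moments of [sech], so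
    the identity can be solved for the top one. *)
Lemma moment_sech_sech2 n :
  pi * 2 ^+ n.*2 * moment sech2 n.*2 = \sum_(k < n.*2.+1) (-1) ^+ k * 'C(n.*2, k)%:R *
    moment sech2 k * moment (@sech R) (n.*2 - k).
Proof.
have mh : measurable_fun setT (fun s : R => pi / 2 * sech (s / 2) ^+ 2).
  apply: measurable_funM => //; apply: measurable_funX.
  by apply: (measurableT_comp measurable_sech); exact: measurable_funM.
have := correlation_moment n (exp_decay_sech2 (R := R)) (exp_decay_sech (R := R)) mh
  (@correlation_sech2 R).
rewrite moment_half ?divr_ge0 ?pi_ge0// -/sech2 => -[<-].
by rewrite exprS; field.
Qed.

Lemma rat_pi_pow_moments n k : (k <= n.*2)%N ->
  rat_pi_pow k (moment sech2 k) /\ rat_pi_pow k.+1 (moment (@sech R) k).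
Proof.
elim: n k => [|n IHn] k'.
  rewrite leqn0 => /eqP ->; rewrite moment0_sech moment0_sech2; split.
    by exists 2; rewrite ratr_nat mulr1.
  by exists 1; rewrite rmorph1 mul1r.
have IHS k : (k < n.+1.*2)%N -> rat_pi_pow k (moment sech2 k) /\ rat_pi_pow k.+1 (moment
  (@sech R) k).
  rewrite doubleS ltnS leq_eqVlt => /predU1P[->|/IHn//].
  rewrite !moment_odd ?oddS ?odd_double//;
    [|exact: exp_decay_sech|exact: sechN|exact: exp_decay_sech2|].
    by split; exact: rat_pi_pow0.
  by move=> x; rewrite /sech2 sechN.
rewrite leq_eqVlt => /predU1P[->|/IHS//].
(* Each product of two moments of [sech] has degree [i.+1 + (n.*2 - i).+1], which is [n.+1.*2]. *)
have N2 : rat_pi_pow n.+1.*2 (moment sech2 n.+1.*2).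
  have [q _ ->] := moment_sech2_succ n; apply: rat_pi_powZ; apply: rat_pi_pow_sum => i.
  have [_ h1] : rat_pi_pow i (moment sech2 i) /\ rat_pi_pow i.+1 (moment (@sech R) i).
    by apply: IHn; rewrite -ltnS.
  have [_ h2] : rat_pi_pow (n.*2 - i) (moment sech2 (n.*2 - i)) /\
      rat_pi_pow (n.*2 - i).+1 (moment (@sech R) (n.*2 - i)).
    by apply: IHn; exact: leq_subr.
  have := rat_pi_powZ ((-1) ^+ i * 'C(n.*2, i)%:R) (rat_pi_powM h1 h2).
  rewrite addSn addnS subnKC -1?ltnS// -doubleS rmorphM rmorphXn rmorphN1/= ratr_nat.
  by rewrite !mulrA.
split=> //.
have := moment_sech_sech2 n.+1.
rewrite big_ord_recl/= expr0 bin0 !mul1r subn0 moment0_sech2 => E.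
have -> : moment (@sech R) n.+1.*2 = ratr 2^-1 * (pi * 2 ^+ n.+1.*2 * moment sech2 n.+1.*2
   + ratr (-1) * \sum_(i < n.+1.*2) (-1) ^+ bump 0 i * 'C(n.+1.*2, bump 0 i)%:R *
      moment sech2 (bump 0 i) * moment (@sech R) (n.+1.*2 - bump 0 i)).
  by rewrite E fmorphV rmorphN1/= ratr_nat; field.
apply: rat_pi_powZ; apply: rat_pi_powD.
  have := rat_pi_powZ (2 ^+ n.+1.*2) (rat_pi_powM (_ : rat_pi_pow 1 pi) N2).
  rewrite rmorphXn/= ratr_nat add1n mulrA (mulrC pi); apply.
  by exists 1; rewrite rmorph1 mul1r.
apply: rat_pi_powZ; apply: rat_pi_pow_sum => i; rewrite /bump/= add1n.
have h1 : rat_pi_pow i.+1 (moment sech2 i.+1).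
  by have := ltn_ord i; rewrite leq_eqVlt => /predU1P[->//|/IHS[]].
have [_ h2] : rat_pi_pow (n.+1.*2 - i.+1) (moment sech2 (n.+1.*2 - i.+1)) /\
    rat_pi_pow (n.+1.*2 - i.+1).+1 (moment (@sech R) (n.+1.*2 - i.+1)).
  by apply: IHS; rewrite ltn_subrL.
have := rat_pi_powZ ((-1) ^+ i.+1 * 'C(n.+1.*2, i.+1)%:R) (rat_pi_powM h1 h2).
rewrite addnS subnKC// rmorphM rmorphXn rmorphN1/= ratr_nat.
by rewrite !mulrA.
Qed.

(** Makes the rational factor in [gamma_const_relation] positive; the integral over [[1, 2]] is
    already a positive lower bound. *)
Lemma moment_sech2_gt0 n : 0 < moment sech2 n.*2.
Proof.
have p0 x : 0 <= x ^+ n.*2 * sech2 x.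
  by rewrite mulr_ge0 ?sqr_ge0// exprn_even_ge0// odd_double.
have mp : measurable_fun setT (fun x => x ^+ n.*2 * sech2 x).
  by apply: measurable_funM; apply: measurable_funX => //; exact: measurable_sech.
rewrite -lte_fin -integral_moment; last exact: exp_decay_sech2.
apply: (@lt_le_trans _ _ (\int[mu]_(x in `[1%R, 2%R]) (cst (sech2 2)%:E) x)%E).
  rewrite integral_cst//= lebesgue_measure_itv/= lte_fin ltr1n -EFinD -EFinM lte_fin.
  by rewrite mulr_gt0 ?exprn_gt0 ?sech_gt0//; lra.
apply: (@le_trans _ _ (\int[mu]_(x in `[1%R, 2%R]) (x ^+ n.*2 * sech2 x)%:E)%E).
  apply: ge0_le_integral => //.
  - by move=> x _; rewrite lee_fin sqr_ge0.
  - by apply/measurable_EFinP/measurable_funTS.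
  - move=> x /=; rewrite in_itv/= => /andP[x1 x2]; rewrite lee_fin.
    rewrite -[leLHS]mul1r ler_pM ?sqr_ge0// ?exprn_ege1// /sech2.
    rewrite ler_pXn2r// ?nnegrE ?(ltW (sech_gt0 _))//.
    rewrite /sech ler_pM2l// lef_pV2 ?posrE ?cosh2_gt0//.
    rewrite !expRN; have := expR_gt0 x; set p := expR x => p1.
    have pq : p <= expR 2 by rewrite ler_expR.
    have p2 : 1 <= p by rewrite -expR0 ler_expR; lra.
    move: pq; set q := expR 2 => pq.
    have : 0 <= (q - p) * (1 - p^-1 * q^-1).
      rewrite mulr_ge0 ?subr_ge0// -invfM invf_le1 ?mulr_gt0//; last by lra.
      by nra.
    rewrite (_ : _ * _ = q + q^-1 - (p + p^-1)) ?subr_ge0//.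
    by field; rewrite !gt_eqF//=; lra.
apply: ge0_subset_integral => //; first exact/measurable_EFinP.
by move=> x _; rewrite lee_fin.
Qed.

Lemma gamma_const_relation n : exists2 q : rat, 0 < q &
  \sum_(k < n.*2.+1) (-1) ^+ k * 'C(n.*2, k)%:R * gamma_const R k
    * gamma_const R (n.*2 - k) = ratr q * pi ^+ n.*2.
Proof.
have mh : measurable_fun setT (fun s : R => 4^-1 * sech (s / 2) ^+ 2).
  apply: measurable_funM => //; apply: measurable_funX.
  by apply: (measurableT_comp measurable_sech); exact: measurable_funM.
have cg s : s != 0 -> (\int[mu]_x (gumbel x * gumbel (x + s))%:E =
    (4^-1 * sech (s / 2) ^+ 2)%:E)%E by rewrite correlation_gumbel mulrC.
have := correlation_moment n (exp_decay_gumbel (R := R)) (exp_decay_gumbel (R := R)) mh cg.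
rewrite moment_half ?invr_ge0// -/sech2 => -[E].
have [[q qE] _] := rat_pi_pow_moments (leqnn n.*2).
have q0 : 0 < q.
  have := moment_sech2_gt0 n; rewrite qE pmulr_lgt0 ?exprn_gt0 ?pi_gt0//.
  by rewrite -(rmorph0 (ratr : rat -> R)) ltr_rat.
(* The quarter comes from the correlation, the power of 2 from rescaling [s / 2]. *)
exists (4^-1 * 2 ^+ n.*2.+1 * q); first by rewrite !mulr_gt0 ?exprn_gt0.
transitivity (4^-1 * 2 ^+ n.*2.+1 * moment sech2 n.*2); first by rewrite E.
by rewrite qE !rmorphM rmorphXn fmorphV/= !ratr_nat mulrA.
Qed.

End rational_multiples.

(** * Transcendence of pi *)

Section complex_exponential.
Context {R : realType}.
Local Notation C := R[i].
Local Notation Re := (@complex.Re R).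
Local Notation Im := (@complex.Im R).
Implicit Types (z w : C) (t : R).
Local Open Scope complex_scope.

Definition cexp z : C := (expR (Re z))%:C * (cos (Im z) +i* sin (Im z)).

Lemma ReD z w : Re (z + w) = Re z + Re w. Proof. by case: z w => [? ?] []. Qed.
Lemma ImD z w : Im (z + w) = Im z + Im w. Proof. by case: z w => [? ?] []. Qed.
Lemma ReN z : Re (- z) = - Re z. Proof. by case: z. Qed.
Lemma ImN z : Im (- z) = - Im z. Proof. by case: z. Qed.
Lemma ReM z w : Re (z * w) = Re z * Re w - Im z * Im w.
Proof. by case: z w => [? ?] []. Qed.
Lemma ImM z w : Im (z * w) = Re z * Im w + Im z * Re w.
Proof. by case: z w => [? ?] []. Qed.

Lemma cexpD z w : cexp (z + w) = cexp z * cexp w.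
Proof.
apply/eqP; rewrite eq_complex /cexp !(ReM, ImM, ReD, ImD)/= expRD cosD sinD.
by apply/andP; split; apply/eqP; ring.
Qed.

Lemma cexp0 : cexp 0 = 1.
Proof. by rewrite /cexp/= expR0 cos0 sin0 mul1r. Qed.

Lemma cexp_ipi : cexp (0 +i* pi) = -1.
Proof. by rewrite /cexp/= expR0 cospi sinpi mul1r; apply/eqP;
  rewrite eq_complex/= oppr0 !eqxx. Qed.

Lemma cexpNK z : cexp z * cexp (- z) = 1.
Proof. by rewrite -cexpD subrr cexp0. Qed.

Lemma cexp_sum (I : Type) (r : seq I) (P : pred I) (F : I -> C) :
  cexp (\sum_(i <- r | P i) F i) = \prod_(i <- r | P i) cexp (F i).
Proof. exact: (big_morph cexp cexpD cexp0). Qed.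

Lemma normc_ge_abs_Re z : `|Re z| <= Re `|z|.
Proof.
by rewrite normc_def/= -sqrtr_sqr ler_sqrt ?lerDl ?addr_ge0 ?sqr_ge0.
Qed.

Lemma normc_ge_abs_Im z : `|Im z| <= Re `|z|.
Proof.
by rewrite normc_def/= -sqrtr_sqr ler_sqrt ?lerDr ?addr_ge0 ?sqr_ge0.
Qed.

Lemma normc_Re z : `|z| = (Re `|z|)%:C.
Proof. by rewrite RRe_real// normr_real. Qed.

Lemma norm_le_ReIm z : Re `|z| <= `|Re z| + `|Im z|.
Proof.
rewrite normc_def/= -[leRHS]ger0_norm ?addr_ge0// -sqrtr_sqr ler_sqrt ?sqr_ge0//.
have h : 0 <= `|Re z| * `|Im z| by rewrite mulr_ge0.
by rewrite sqrrD !real_normK ?num_real// mulr2n; lra.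
Qed.

Lemma norm_cexp z : `|cexp z| = (expR (Re z))%:C.
Proof.
rewrite normrM normc_def/= expr0n/= addr0 sqrtr_sqr ger0_norm ?expR_ge0//.
by rewrite normc_def/= cos2Dsin2 sqrtr1 mulr1.
Qed.

(** Componentwise in a real variable, so that the real mean value theorem applies to each part. *)
Definition is_cderive (F : R -> C) t (d : C) :=
  is_derive t 1 (fun t => Re (F t)) (Re d) /\ is_derive t 1 (fun t => Im (F t)) (Im d).

Lemma is_cderiveM F G t d e : is_cderive F t d -> is_cderive G t e ->
  is_cderive (fun t => F t * G t) t (d * G t + F t * e).
Proof.
move=> [F1 F2] [G1 G2]; split.
  under eq_fun do rewrite ReM.
  by apply: is_derive_eq; rewrite !(ReD, ReM) /GRing.scale/=; ring.
under eq_fun do rewrite ImM.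
by apply: is_derive_eq; rewrite !(ImD, ImM) /GRing.scale/=; ring.
Qed.

Lemma is_cderiveD F G t d e : is_cderive F t d -> is_cderive G t e ->
  is_cderive (fun t => F t + G t) t (d + e).
Proof.
move=> [F1 F2] [G1 G2]; split.
  under eq_fun do rewrite ReD.
  by apply: is_derive_eq; rewrite !ReD.
under eq_fun do rewrite ImD.
by apply: is_derive_eq; rewrite !ImD.
Qed.

Lemma is_cderive_cst z t : is_cderive (fun=> z) t 0.
Proof. by split; exact: is_derive_cst. Qed.

Lemma is_cderive_lin z t : is_cderive (fun t => t%:C * z) t z.
Proof.
split.
  under eq_fun do rewrite ReM/= mul0r subr0.
  by apply: is_derive_eq; rewrite /GRing.scale/=; ring.
under eq_fun do rewrite ImM/= mul0r addr0.
by apply: is_derive_eq; rewrite /GRing.scale/=; ring.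
Qed.

Lemma is_cderive_cexp z t : is_cderive (fun t => cexp (t%:C * z)) t (z * cexp (t%:C * z)).
Proof.
split.
  under eq_fun do rewrite /cexp !(ReM, ImM)/= !mul0r !subr0 !addr0.
  by apply: is_derive_eq;
    rewrite /cexp !(ReM, ImM)/= /GRing.scale/= !mul0r !(subr0, addr0); ring.
under eq_fun do rewrite /cexp !(ReM, ImM)/= !mul0r !subr0 !addr0.
by apply: is_derive_eq;
  rewrite /cexp !(ReM, ImM)/= /GRing.scale/= !mul0r !(subr0, addr0); ring.
Qed.

Definition exp_trunc (m : nat) z : C := \sum_(k < m.+1) z ^+ k / k`!%:R.

Lemma exp_trunc0 m : exp_trunc m 0 = 1.
Proof.
rewrite /exp_trunc big_ord_recl expr0 fact0 divr1 big1 ?addr0// => i _.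
by rewrite exprS !mul0r.
Qed.

Lemma is_cderive_exp_trunc m z t : is_cderive (fun t => exp_trunc m (t%:C * z)) t
  (z * (exp_trunc m (t%:C * z) - (t%:C * z) ^+ m / m`!%:R)).
Proof.
elim: m => [|m IHm].
  rewrite /exp_trunc; under eq_fun do rewrite big_ord1 expr0 fact0 divr1.
  by rewrite big_ord1 subrr mulr0; exact: is_cderive_cst.
have E w : exp_trunc m.+1 w = exp_trunc m w + w ^+ m.+1 / m.+1`!%:R.
  by rewrite /exp_trunc big_ord_recr.
under eq_fun do rewrite E; rewrite E addrK.
have -> : z * exp_trunc m (t%:C * z) =
  z * (exp_trunc m (t%:C * z) - (t%:C * z) ^+ m / m`!%:R) + z * (t%:C * z) ^+ m / m`!%:R.
  by rewrite mulrBr mulrA subrK.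
apply: is_cderiveD => //.
have : forall k, is_cderive (fun t => (t%:C * z) ^+ k) t (k%:R * z * (t%:C * z) ^+ k.-1).
  elim=> [|k IHk].
    under eq_fun do rewrite expr0.
    by rewrite !mul0r; exact: is_cderive_cst.
  under eq_fun do rewrite exprS.
  have := is_cderiveM (is_cderive_lin z t) IHk; congr is_cderive.
  case: k {IHk} => [|k] /=; first by rewrite expr0; ring.
  have -> : (k.+2%:R : C) = k.+1%:R + 1 by rewrite natr1.
  by rewrite !exprS; ring.
move=> /(_ m.+1) h.
have := is_cderiveM h (is_cderive_cst (m.+1`!%:R)^-1 t); congr is_cderive.
rewrite mulr0 addr0 /= factS natrM; field.
by rewrite nat1r !pnatr_eq0 -lt0n fact_gt0.
Qed.

(* The derivative of [cexp (- t z) * exp_trunc m (t z)] is a single monomial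
   times [cexp (- t z)]; apply the mean value theorem to both components. *)
Lemma cexp_trunc_bound m z :
  `|m`!%:R * (cexp z - exp_trunc m z)| <= (2 * expR (2 * Re `|z|))%:C * `|z| ^+ m.+1.
Proof.
pose F t := cexp (t%:C * - z) * exp_trunc m (t%:C * z).
pose dF t := - z * cexp (t%:C * - z) * ((t%:C * z) ^+ m / m`!%:R).
have dFE t : is_cderive F t (dF t).
  have := is_cderiveM (is_cderive_cexp (- z) t) (is_cderive_exp_trunc m z t).
  by congr is_cderive; rewrite /dF; ring.
pose r := Re `|z|; have r0 : 0 <= r by have := normr_ge0 z; rewrite normc_Re ler0c.
pose b := r ^+ m.+1 * expR r / m`!%:R.
have dFb t : 0 <= t <= 1 -> Re `|dF t| <= b.
  move=> /andP[t0 t1].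
  have -> : `|dF t| = (r * expR (Re (t%:C * - z)) * ((t * r) ^+ m / m`!%:R))%:C.
    rewrite /dF; have := norm_cexp (t%:C * - z); move: (cexp _) => e eE.
    rewrite !normrM normrN eE normrX normrM normfV normr_nat.
    rewrite (ger0_norm (_ : 0 <= t%:C)) ?ler0c// [`|z|]normc_Re -/r.
    by rewrite !rmorphM rmorphXn rmorphM fmorphV rmorph_nat.
  have h1 : expR (Re (t%:C * - z)) <= expR r.
    rewrite ler_expR ReM ReN/= mul0r subr0 mulrN.
    have := normc_ge_abs_Re z; rewrite -/r ler_norml => /andP[h1 h2]; nra.
  have h2 : t ^+ m <= 1 by rewrite exprn_ile1.
  have -> : Re (r * expR (Re (t%:C * - z)) * ((t * r) ^+ m / m`!%:R))%:C =
      expR (Re (t%:C * - z)) * t ^+ m * (r ^+ m.+1 / m`!%:R).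
    by rewrite [LHS]/= exprMn exprS; ring.
  have -> : b = expR r * 1 * (r ^+ m.+1 / m`!%:R) by rewrite /b; ring.
  rewrite ler_wpM2r ?divr_ge0 ?exprn_ge0// ler_pM ?expR_ge0 ?exprn_ge0//.
have Fb (p : C -> R) : (forall w, `|p w| <= Re `|w|) ->
    (forall t, is_derive t 1 (fun t => p (F t)) (p (dF t))) ->
    `|p (F 1) - p (F 0)| <= b.
  move=> pn dp.
  have [|c] := @MVT R (fun t => p (F t)) (fun t => p (dF t)) 0 1 ltr01 (fun t _ => dp t).
    by apply: derivable_within_continuous => t _; case: (dp t).
  rewrite in_itv/= => /andP[c0 c1] ->; rewrite subr0 mulr1.
  by apply: le_trans (pn _) (dFb _ _); rewrite !ltW.
have b1 := Fb Re normc_ge_abs_Re (fun t => (dFE t).1).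
have b2 := Fb Im normc_ge_abs_Im (fun t => (dFE t).2).
(* The factor 2 is the price of treating real and imaginary parts separately. *)
have dn : Re `|F 1 - F 0| <= 2 * b.
  apply: le_trans (norm_le_ReIm _) _; rewrite !(ReD, ReN, ImD, ImN).
  by move: b1 b2; lra.
have -> : cexp z - exp_trunc m z = - (cexp z * (F 1 - F 0)).
  rewrite /F !mul1r !mul0r cexp0 mul1r.
  by rewrite exp_trunc0 mulrBr mulrA cexpNK mul1r mulr1 opprB.
rewrite normrM normrN normr_nat; have := norm_cexp z; move: (cexp z) => e eE.
rewrite normrM eE [`|_ - _|]normc_Re [`|z|]normc_Re -/r.
rewrite -(rmorph_nat (real_complex R)) -!rmorphM -rmorphXn -rmorphM lecR.
have m0 : (m`!%:R : R) != 0 by rewrite pnatr_eq0 -lt0n fact_gt0.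
apply: (@le_trans _ _ (m`!%:R * (expR r * (2 * b)))).
  rewrite ler_wpM2l// ler_pM ?expR_ge0//; first by rewrite -ler0c -normc_Re.
  by rewrite ler_expR; apply: le_trans (normc_ge_abs_Re z); exact: ler_norm.
rewrite /b (_ : 2 * r = r + r) ?expRD; last by ring.
by rewrite le_eqVlt; apply/orP; left; apply/eqP; field.
Qed.

End complex_exponential.

(** * Derivatives at multiple roots; coefficientwise majorants *)

Section polynomial_facts.

Lemma derivn_coef0 (A : comNzRingType) (p : {poly A}) k : p^`(k).[0] = p`_k *+ k`!.
Proof. by rewrite horner_coef0 coef_derivn addn0 ffactnn. Qed.

Lemma derivn_root (A : comNzRingType) (w : A) n k (u : {poly A}) : (k < n)%N ->
  (('X - w%:P) ^+ n * u)^`(k).[w] = 0.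
Proof.
elim: k n u => [|k IHk] [|n] u // kn.
  by rewrite /= hornerM horner_exp !hornerE subrr expr0n mul0r.
rewrite derivSn derivM deriv_exp derivB derivX derivC subr0 mul1r /=.
rewrite (_ : _ + _ = ('X - w%:P) ^+ n * (u *+ n.+1 + ('X - w%:P) * u^`()));
  first exact: IHk.
by rewrite mulrDr mulrA -exprSr mulrnAl mulrnAr.
Qed.

(** Domination of coefficients passes to products and powers, so a high power is estimated from its
    base without being expanded. *)
Definition majorized (C : numDomainType) (f F : {poly C}) := forall i, `|f`_i| <= F`_i.

Lemma majorizedM (C : numDomainType) (f g F G : {poly C}) :
  majorized f F -> majorized g G -> majorized (f * g) (F * G).
Proof.
move=> fF gG i; rewrite !coefM; apply: le_trans (ler_norm_sum _ _ _) _.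
by apply: ler_sum => j _; rewrite normrM ler_pM.
Qed.

Lemma majorizedX (C : numDomainType) (f F : {poly C}) n :
  majorized f F -> majorized (f ^+ n) (F ^+ n).
Proof.
move=> fF; elim: n => [|n IHn]; last by rewrite !exprS; exact: majorizedM.
by move=> i; rewrite !expr0 coef1; case: eqP => _; rewrite ?normr1 ?normr0.
Qed.

Lemma majorized_horner (C : numDomainType) (f F : {poly C}) (r : C) :
  majorized f F -> 0 <= r -> \sum_(i < size f) `|f`_i| * r ^+ i <= F.[r].
Proof.
move=> fF r0; have sf : (size f <= size F)%N.
  apply/leq_sizeP => j Fj; have := fF j; rewrite (nth_default 0 Fj) normr_le0 => /eqP->//.
rewrite horner_coef (big_ord_widen _ (fun i => `|f`_i| * r ^+ i) sf) big_mkcond/=.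
apply: ler_sum => i _; case: ifP => _; first by rewrite ler_wpM2r ?exprn_ge0.
by rewrite mulr_ge0 ?exprn_ge0// (le_trans _ (fF i)).
Qed.

End polynomial_facts.

(** * Hermite's simultaneous approximations to exponentials *)

Section hermite.
Context {R : realType}.
Local Notation C := R[i].

(* For [f = \sum_m f_m X^m] this is [\sum_m f_m c^m m! exp_trunc m (w / c)], an
   approximation of [hermite c N f 0 * cexp (w / c)]. *)
Definition hermite (c : C) N (f : {poly C}) (w : C) : C :=
  \sum_(k < N) c ^+ k * f^`(k).[w].

Lemma hermite_expand c N f w : hermite c N f w =
  \sum_(m < size f) f`_m * \sum_(k < N) c ^+ k * (w ^+ (m - k) *+ m ^_ k).
Proof.
rewrite /hermite.
under [RHS]eq_bigr do rewrite mulr_sumr.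
rewrite exchange_big/=; apply: eq_bigr => k _.
have -> : f^`(k) = \sum_(m < size f) f`_m *: ('X^(m - k) *+ m ^_ k).
  rewrite -{1}[f]coefK poly_def (linear_sum (derivn k)).
  by apply: eq_bigr => m _; rewrite linearZ/= derivnXn.
rewrite horner_sum mulr_sumr; apply: eq_bigr => m _.
rewrite hornerZ hornerMn hornerXn.
by rewrite mulrCA.
Qed.

(** Since [m ^_ k] is [m! / (m - k)!], reading the sum backwards gives [m!] times a Taylor
    polynomial; [m < N] ensures that no nonzero derivative is cut off. *)
Lemma hermite_Xn (c z : C) N m : (m < N)%N ->
  \sum_(k < N) c ^+ k * ((c * z) ^+ (m - k) *+ m ^_ k) = c ^+ m * (m`!%:R * exp_trunc m z).
Proof.
move=> mN; rewrite (bigID (fun k : 'I_N => (k < m.+1)%N))/= [X in _ + X]big1 ?addr0;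
  last first.
  by move=> k; rewrite -leqNgt => mk; rewrite ffact_small// mulr0n mulr0.
rewrite -(big_ord_widen _ (fun k => c ^+ k * ((c * z) ^+ (m - k) *+ m ^_ k)) mN).
rewrite /exp_trunc !mulr_sumr (reindex_inj rev_ord_inj)/=.
apply: eq_bigr => k _; have km : (k <= m)%N by rewrite -ltnS.
rewrite subSS subKn// exprMn -mulr_natr.
have -> : (m ^_ (m - k))%:R = m`!%:R / k`!%:R :> C.
  apply: (mulIf (_ : k`!%:R != 0 :> C)); first by rewrite pnatr_eq0 -lt0n fact_gt0.
  rewrite divfK ?pnatr_eq0 -?lt0n ?fact_gt0// -natrM -(ffact_fact (leq_subr k m)).
  by rewrite subKn.
have -> : c ^+ m = c ^+ (m - k) * c ^+ k by rewrite -exprD subnK.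
ring.
Qed.

(** [K] depends on [z] alone, so for Hermite's polynomials the error grows only geometrically in the
    prime, against a factorial lower bound. *)
Lemma hermite_bound (z : C) : exists2 K : C, 0 <= K &
  forall c N (f F : {poly C}), (size f <= N)%N -> majorized f F ->
  `|hermite c N f 0 * cexp z - hermite c N f (c * z)| <= K * F.[`|c * z|].
Proof.
have [K K0 hK] : exists2 K : C, 0 <= K &
    forall m, `|m`!%:R * (cexp z - exp_trunc m z)| <= K * `|z| ^+ m.
  exists ((2 * expR (2 * complex.Re `|z|))%:C%C * `|z|).
    by rewrite mulr_ge0// ler0c mulr_ge0// expR_ge0.
  by move=> m; rewrite -mulrA -exprS; exact: cexp_trunc_bound.
exists K => // c N f F fN fF.
rewrite -{1}(mulr0 c) !hermite_expand mulr_suml -sumrB.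
apply: le_trans (ler_norm_sum _ _ _) _.
apply: le_trans (ler_wpM2l K0 (majorized_horner fF (normr_ge0 _))).
rewrite mulr_sumr; apply: ler_sum => m _.
have mN : (m < N)%N by apply: leq_trans fN.
rewrite !hermite_Xn//.
rewrite exp_trunc0.
rewrite (_ : _ - _ = f`_m * c ^+ m * (m`!%:R * (cexp z - exp_trunc m z))); last by ring.
rewrite normrM (normrM f`_m) (normrM c) exprMn normrX.
rewrite (_ : K * _ = `|f`_m| * `|c| ^+ m * (K * `|z| ^+ m)); last by ring.
by rewrite ler_wpM2l// mulr_ge0 ?exprn_ge0.
Qed.

End hermite.

(** * Non-vanishing of a sum of exponentials *)

Section lindemann.
Context {R : realType}.
Local Notation C := R[i].
Local Notation toC := (map_poly (intr : int -> C)).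

Lemma geometric_lt_fact (A M : R) (n0 : nat) :
  exists q : nat, [/\ prime q, (n0 < q)%N & A * M ^+ q < (q.-1)`!%:R].
Proof.
have h : A * M * (M ^+ n / n`!%:R) @[n --> \oo] --> (A * M * 0 : R).
  by apply: cvgM; [exact: cvg_cst|exact: cvg_exp_coeff].
rewrite mulr0 in h.
have /cvgrPdist_lt/(_ 1 ltr01)[m _ hm] := h.
have [q qlt pq] := prime_above (maxn m.+1 n0).
have := qlt; rewrite gtn_max => /andP[mq nq].
exists q; split => //.
have q0 : q = q.-1.+1 by rewrite prednK// prime_gt0.
have /= := hm q.-1; rewrite sub0r normrN => /(_ _)/(le_lt_trans (ler_norm _)).
have mq1 : (m <= q.-1)%N by rewrite -ltnS -q0 ltnW.
move=> /(_ mq1); rewrite mulrA ltr_pdivrMr ?mul1r ?ltr0n ?fact_gt0//.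
have -> : M ^+ q = M * M ^+ q.-1 by rewrite -exprS -q0.
by rewrite -!mulrA.
Qed.

(** The [k]-th derivative of an integer polynomial is [k!] times an integer polynomial, and [q!]
    divides [k!]. *)
Lemma sum_derivn_int (T : finType) (a : T -> C) (f : {poly int}) k q :
  (forall h : {poly int}, exists n : int, \sum_i (toC h).[a i] = n%:~R) -> (q <= k)%N ->
  exists n : int, \sum_i (toC f)^`(k).[a i] = q`!%:R * n%:~R.
Proof.
move=> ha qk; have [n nE] := ha f^`N(k).
exists ((k ^_ (k - q))%:R * n).
rewrite derivn_map nderivn_def rmorphMn/= .
under eq_bigr do rewrite hornerMn.
rewrite sumrMnl nE -[LHS]mulr_natl -(ffact_fact (leq_subr q k)) subKn// natrM.
by rewrite rmorphM/= rmorph_nat; ring.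
Qed.

(* Hermite's choice is [f = X^(q-1) B^q] with [q] a large prime and [B] the part of
   [P] without the root 0: the sum of [hermite c N f (a i)] is [(q-1)!] times an
   integer prime to [q], while the vanishing of the sum of exponentials bounds it
   by [A M^q]. *)
Lemma hermite_lindemann (T : finType) (a : T -> C) (c : int) (P : {poly int}) :
  c != 0 -> toC P = \prod_i ('X - (a i)%:P) ->
  (forall h : {poly int}, exists n : int, \sum_i (toC h).[a i] = n%:~R) ->
  (exists i, a i = 0) -> \sum_i cexp (a i / c%:~R) != 0.
Proof.
move=> c0 PE ha [i0 ai0]; apply/eqP => sum0.
have c0C : c%:~R != 0 :> C by rewrite intr_eq0.
pose n0 := #|[pred i | a i == 0]|.
have n0_gt0 : (0 < n0)%N by apply/card_gt0P; exists i0; rewrite inE ai0.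
pose BC := \prod_(i | a i != 0) ('X - (a i)%:P).
have PE' : toC P = 'X^n0 * BC.
  rewrite PE (bigID (fun i => a i == 0))/=; congr (_ * _).
  under eq_bigr => i /eqP -> do rewrite subr0.
  by rewrite prodr_const.
pose B := drop_poly n0 P.
have BE : toC B = BC.
  apply/polyP => i; rewrite coef_map coef_drop_poly/= -(coef_map (intr : int -> C)) PE'.
  by rewrite coefXnM ltnNge leq_addl addnK.
have B0 : B`_0 != 0.
  rewrite -(intr_eq0 C) -coef_map BE -horner_coef0 horner_prod.
  by apply/prodf_neq0 => i ai; rewrite !hornerE ?(sub0r, add0r) oppr_eq0.
pose F := \poly_(i < size BC) `|BC`_i|.
have BF : majorized BC F.
  by move=> i; rewrite coef_poly; case: ltnP => // h; rewrite nth_default// normr0.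
have F0 (r : C) : 0 <= r -> 0 <= F.[r].
  move=> r0; rewrite horner_poly sumr_ge0// => i _.
  by rewrite mulr_ge0 ?exprn_ge0.
pose K i := sval (cid2 (hermite_bound (a i / c%:~R))).
have K0 i : 0 <= K i by rewrite /K; case: cid2.
have hK i N (f G : {poly C}) : (size f <= N)%N -> majorized f G ->
    `|hermite c%:~R N f 0 * cexp (a i / c%:~R) - hermite c%:~R N f (a i)| <= K i * G.[`|a
      i|].
  move=> fN fG; rewrite /K; case: cid2 => /= k _ /(_ c%:~R N f G fN fG).
  by rewrite (_ : c%:~R * (a i / c%:~R) = a i)// mulrC divfK.
pose A := \sum_i K i.
(* The added 1 gives [M1 >= 1], so that [M1 ^+ q.-1] may be replaced by [M1 ^+ q]. *)
pose M1 := 1 + \sum_i `|a i|; pose M2 := 1 + \sum_i F.[`|a i|].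
have aM i : `|a i| <= M1.
  rewrite /M1 (bigD1 i)//= addrCA lerDl addr_ge0// sumr_ge0// => j _.
have FM i : F.[`|a i|] <= M2.
  by rewrite /M2 (bigD1 i)//= addrCA lerDl addr_ge0// sumr_ge0// => j _; exact: F0.
pose M := M1 * M2.
have A0 : 0 <= A by exact: sumr_ge0.
have M1_ge1 : 1 <= M1 by rewrite lerDl sumr_ge0.
have M2_ge0 : 0 <= M2 by rewrite addr_ge0// sumr_ge0// => i _; exact: F0.
have M_ge0 : 0 <= M by rewrite mulr_ge0// (le_trans _ M1_ge1).
(* A prime larger than [n0], [|c|] and the absolute value of the constant term of [B] divides none
   of them. *)
have [q [pq qn qM]] := geometric_lt_fact (complex.Re A) (complex.Re M)
  (maxn n0 (maxn `|c| `|B`_0|)).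
have q_gt0 := prime_gt0 pq.
pose f := 'X^(q.-1) * B ^+ q.
have fE : toC f = 'X^(q.-1) * BC ^+ q by rewrite rmorphM !rmorphXn/= map_polyX BE.
pose N := (size (toC f) + q)%N.
pose D k := \sum_i (toC f)^`(k).[a i].
have DS : \sum_i hermite c%:~R N (toC f) (a i) = \sum_(k < N) c%:~R ^+ k * D k.
  by rewrite exchange_big/=; apply: eq_bigr => k _; rewrite mulr_sumr.
(* Every [a i] is a root of [f] of multiplicity at least [q.-1]. *)
have Dlt k : (k < q.-1)%N -> D k = 0.
  move=> kq; rewrite /D big1// => i _; have [ai|ai] := eqVneq (a i) 0.
    by rewrite fE -['X]subr0 -[0]polyC0 -ai derivn_root.
  rewrite fE /BC (bigD1 i)//= exprMn mulrCA.
  by rewrite derivn_root//; apply: leq_trans kq (leq_pred _).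
(* The nonzero [a i] are roots of multiplicity at least [q], so at this order only the [n0] zero
   exponents contribute. *)
have Dq1 : D q.-1 = n0%:R * (q.-1`!%:R * (B`_0)%:~R ^+ q).
  rewrite /D (bigID (fun i => a i == 0))/= [X in _ + X]big1 ?addr0; last first.
    move=> i ai; rewrite fE /BC (bigD1 i)//= exprMn mulrCA.
    by rewrite derivn_root// prednK.
  rewrite (eq_bigr (fun=> q.-1`!%:R * (B`_0)%:~R ^+ q)).
    by rewrite sumr_const [RHS]mulr_natl.
  move=> i /eqP ->; rewrite derivn_coef0 fE coefXnM ltnn subnn -BE -rmorphXn/=.
  rewrite coef_map/= -[LHS]mulr_natl -horner_coef0 horner_exp horner_coef0.
  by rewrite rmorphXn.
have [I DI] : exists I : int, \sum_(k < N) c%:~R ^+ k * D k =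
    q.-1`!%:R * (n0%:R * c ^+ q.-1 * B`_0 ^+ q + q%:R * I)%:~R.
  have Dge (k : 'I_N) : exists n : int, (q <= k)%N -> D k = q`!%:R * n%:~R.
    have [qk|] := leqP q k; last by exists 0.
    by have [n nE] := sum_derivn_int f ha qk; exists n.
  have [g gE] := choice Dge.
  have q1N : (q.-1 < N)%N by rewrite prednK// leq_addl.
  exists (\sum_(k < N | (q <= k)%N) c ^+ k * g k).
  rewrite (bigD1 (Ordinal q1N))//= Dq1 (bigID (fun k : 'I_N => (q <= k)%N))/=.
  rewrite [X in _ + (_ + X)]big1 ?addr0; last first.
    move=> k /andP[k1]; rewrite -ltnNge => kq; rewrite Dlt ?mulr0//.
    rewrite ltn_neqAle -ltnS prednK// kq andbT.
    by move: k1; apply: contra => /eqP kE; apply/eqP/val_inj.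
  rewrite rmorphD/= !rmorphM !rmorphXn/= !rmorph_nat mulrDr; congr (_ + _).
    by ring.
  rewrite rmorph_sum/= mulr_sumr mulr_sumr.
  rewrite (eq_bigl (fun k : 'I_N => (q <= k)%N)).
    apply: eq_bigr => k qk; rewrite (gE _ qk) rmorphM rmorphXn/=.
    by rewrite -[in LHS](prednK q_gt0) factS natrM prednK//; ring.
  move=> k; have [->|//] := eqVneq k (Ordinal q1N).
  by rewrite /= leqNgt prednK ?leqnn.
set J := n0%:R * _ * _ + _ in DI.
(* Modulo [q] only [n0 * c ^ q.-1 * B_0 ^ q] survives, and [q] divides no factor of it. *)
have J0 : J != 0.
  move: qn; rewrite !gtn_max => /and3P[qn0 qc qB].
  apply/eqP => J0; have /(congr1 absz) : n0%:R * c ^+ q.-1 * B`_0 ^+ q = - (q%:R * I).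
    by apply/eqP; rewrite -addr_eq0 -/J J0.
  rewrite abszN !abszM !abszX !natz !absz_nat => XE.
  have : (q %| n0 * absz c ^ q.-1 * absz (B`_0)%R ^ q)%N by rewrite XE dvdn_mulr.
  by rewrite !Euclid_dvdM// !Euclid_dvdX// !gtnNdvd ?absz_gt0.
have upper : `|\sum_i hermite c%:~R N (toC f) (a i)| <= A * M ^+ q.
  have -> : \sum_i hermite c%:~R N (toC f) (a i) =
    - \sum_i (hermite c%:~R N (toC f) 0 * cexp (a i / c%:~R) - hermite c%:~R N (toC f) (a
        i)).
    by rewrite sumrB -mulr_sumr sum0 mulr0 sub0r opprK.
  rewrite normrN (le_trans (ler_norm_sum _ _ _))// mulr_suml; apply: ler_sum => i _.
  have maj : majorized (toC f) ('X^(q.-1) * F ^+ q).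
    rewrite fE; apply: majorizedM; last exact: majorizedX.
    by move=> j; rewrite coefXn; case: eqP => _; rewrite ?normr1 ?normr0.
  apply: le_trans (hK i _ _ _ (leq_addr _ _) maj) _.
  rewrite ler_wpM2l// hornerM hornerXn horner_exp /M exprMn.
  rewrite ler_pM ?exprn_ge0 ?F0// ?lerXn2r ?nnegrE ?F0//.
  apply: (@le_trans _ _ (M1 ^+ q.-1));
    first by rewrite lerXn2r ?nnegrE// (le_trans _ M1_ge1).
  by rewrite ler_weXn2l// leq_pred.
have lower : q.-1`!%:R <= `|\sum_i hermite c%:~R N (toC f) (a i)|.
  rewrite DS DI normrM normr_nat ler_peMr// -intr_norm -[1]/(1%:~R) ler_int.
  by rewrite -gtz0_ge1 normr_gt0.
have := le_trans lower upper.
rewrite -(RRe_real (ger0_real A0)) -(RRe_real (ger0_real M_ge0)).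
rewrite -(rmorph_nat (real_complex R)) -rmorphXn -rmorphM lecR.
by rewrite leNgt qM.
Qed.
End lindemann.

(** * Symmetric functions of the roots of an integer polynomial *)

Section symmetric_integers.
Context {C : fieldType} (d : nat) (al : d.-tuple C) (g : {poly int}).
Context (gE : map_poly (intr : int -> C) g = \prod_(x <- al) ('X - x%:P)).
Local Notation M := (mpoly.mpoly d int).
Local Notation "''X_' i" := (mpoly.mpolyX int (mpoly.mnm1 i)).
Local Notation ev := (mpoly.mmap (intr : int -> C) (tnth al)).
Local Notation toC := (map_poly (intr : int -> C)).

(** Vieta's formulas: up to sign these are coefficients of [g], and beyond [d] they vanish. *)
Lemma mesym_int k : exists n : int, ev (mpoly.mesym d int k) = n%:~R.
Proof.
have [dk|kd] := ltnP d k.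
  by exists 0; rewrite mpoly.mesym_geqnE// mpoly.mmap0.
have kd' : (k < d.+1)%N by [].
exists ((-1) ^+ k * g`_(d - k)).
have := mpoly.mroots_coeff al (Ordinal kd'); rewrite -gE coef_map/= => E.
rewrite rmorphM rmorphXn rmorphN1/= E mulrA -exprMn mulN1r opprK expr1n mul1r.
rewrite /mpoly.mesym !raddf_sum/=; apply: eq_bigr => h _.
rewrite !rmorph_prod/=; apply: eq_bigr => i _.
by rewrite mpoly.mevalXU mpoly.mmapX mpoly.mmap1U.
Qed.

Lemma symmetric_int (p : M) : p \is mpoly.symmetric ->
  exists n : int, ev p = n%:~R.
Proof.
move=> /mpoly.sym_fundamental[t [<- _]].
have [v vE] := choice mesym_int.
exists (\sum_(m <- mpoly.msupp t) mpoly.mcoeff m t * \prod_(i < d) v i.+1 ^+ m i).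
rewrite mpoly.comp_mpolyEX !raddf_sum/=; apply: eq_bigr => m _.
rewrite mpoly.mmapZ rmorphM/= mpoly.comp_mpolyX !rmorph_prod/=; congr (_ * _).
by apply: eq_bigr => i _; rewrite !rmorphXn/= tnth_mktuple vE.
Qed.

Definition subset_sum (S : {set 'I_d}) : C := \sum_(j in S) tnth al j.
Local Notation L := (fun S : {set 'I_d} => \sum_(j in S) 'X_j : M).

Lemma ev_subset_sum S : ev (L S) = subset_sum S.
Proof.
rewrite raddf_sum/=; apply: eq_bigr => j _.
by rewrite mpoly.mmapX mpoly.mmap1U.
Qed.

Lemma msym_subset_sum s S : mpoly.msym s (L S) = L (s @: S).
Proof.
rewrite raddf_sum/= big_imset/=; last by move=> i j _ _; exact: perm_inj.
by apply: eq_bigr => j _; rewrite /mpoly.msym mpoly.mmapX mpoly.mmap1U.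
Qed.

Lemma imset_perm_inj (s : 'S_d) : injective (fun S : {set 'I_d} => s @: S).
Proof. by apply: imset_inj; exact: perm_inj. Qed.

(** Permuting the roots permutes the subsets, so the sum over all subsets, formed with
    indeterminates, is symmetric; [symmetric_int] then evaluates it at the roots. *)
Lemma subset_sum_int (h : {poly int}) :
  exists n : int, \sum_S (toC h).[subset_sum S] = n%:~R.
Proof.
pose mC := @mpoly.mpolyC d int.
pose p : M := \sum_S (map_poly mC h).[L S].
have psym : p \is mpoly.symmetric.
  apply/mpoly.issymP => s; rewrite /p raddf_sum/=.
  rewrite [RHS](reindex_inj (@imset_perm_inj s)); apply: eq_bigr => S _.
  rewrite -horner_map/= msym_subset_sum -map_poly_comp/=; congr (_.[_]).
  by apply: eq_map_poly => x /=; rewrite /mpoly.msym mpoly.mmapC.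
have [n nE] := symmetric_int psym; exists n; rewrite -nE /p raddf_sum/=.
apply: eq_bigr => S _; rewrite -horner_map/= ev_subset_sum -map_poly_comp/=.
by congr (_.[_]); apply: eq_map_poly => x /=; rewrite mpoly.mmapC.
Qed.

Lemma subset_sum_poly : exists P : {poly int},
  toC P = \prod_S ('X - (subset_sum S)%:P).
Proof.
pose U : {poly M} := \prod_S ('X - (L S)%:P).
have Usym i : U`_i \is mpoly.symmetric.
  apply/mpoly.issymP => s; rewrite -coef_map (_ : map_poly _ U = U)//.
  rewrite /U rmorph_prod/= [RHS](reindex_inj (@imset_perm_inj s)).
  by apply: eq_bigr => S _; rewrite rmorphB/= map_polyX map_polyC/= msym_subset_sum.
have [n nE] := choice (fun i => symmetric_int (Usym i)).
exists (\poly_(i < size U) n i).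
transitivity (map_poly ev U).
  apply/polyP => i; rewrite !coef_map/= coef_poly nE.
  by case: ltnP => // Ui; rewrite -nE (nth_default 0 Ui) !raddf0.
rewrite /U rmorph_prod/=; apply: eq_bigr => S _.
by rewrite rmorphB/= map_polyX map_polyC/= ev_subset_sum.
Qed.

End symmetric_integers.

(** * Lindemann's argument for pi *)

Section pi_transcendental.

Lemma algebraic_monic_int (F : numFieldType) (x : F) :
  algebraicOver (ratr : rat -> F) x -> exists2 c : int, c != 0 &
    exists2 g : {poly int}, g \is monic & root (map_poly intr g) (c%:~R * x).
Proof.
move=> [p p0 px].
have [q [a a0 pE]] := rat_poly_scale p.
have q0 : q != 0 by apply: contra_neq p0 => q0; rewrite pE q0 map_poly0 scaler0.
have qx : root (map_poly intr q) x.
  move: px; rewrite pE linearZ/= rootZ ?fmorph_eq0 ?invr_eq0 ?intr_eq0//.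
  rewrite -map_poly_comp/= (eq_map_poly (g := intr))// => i /=.
  by rewrite ratr_int.
pose d := (size q).-1; pose c := lead_coef q.
have d0 : (0 < d)%N.
  rewrite /d -subn1 subn_gt0 ltnNge; apply/negP => /size1_polyC qE.
  move: qx q0; rewrite qE map_polyC/= rootC intr_eq0 => /eqP ->.
  by rewrite eqxx.
have c0 : c != 0 by rewrite lead_coef_eq0.
exists c => //.
(* This is [c ^ d.-1 * q(X / c)]; degree [d] is set apart because [d.-1 - d] truncates to 0. *)
pose g := \poly_(i < d.+1) (if i == d then 1 else q`_i * c ^+ (d.-1 - i)).
have gd : g`_d = 1 by rewrite coef_poly leqnn eqxx.
have sg : size g = d.+1.
  by rewrite size_poly_eq ?eqxx ?oner_eq0.
exists g; first by rewrite monicE lead_coefE sg gd.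
rewrite rootE horner_coef size_map_poly_id0 ?sg; last first.
  by rewrite intr_eq0 lead_coefE sg gd oner_eq0.
have sq : size q = d.+1 by rewrite /d prednK ?size_poly_gt0.
have : c%:~R ^+ d.-1 * (map_poly intr q).[x] = 0 by rewrite (rootP qx) mulr0.
rewrite horner_coef size_map_poly_id0 ?sq; last by rewrite intr_eq0.
rewrite mulr_sumr => E; apply/eqP; rewrite -[RHS]E; apply: eq_bigr => i _.
rewrite !coef_map/= coef_poly ltn_ord exprMn; case: eqP => [->|/eqP id].
  rewrite -(prednK d0) exprS [in LHS]/= /c lead_coefE -/d prednK//; ring.
have il : (i <= d.-1)%N by rewrite -ltnS prednK// ltn_neqAle id -ltnS ltn_ord.
rewrite rmorphM rmorphXn/= -[in RHS](subnK il) exprD; ring.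
Qed.

Theorem pi_transcendental (R : realType) : ~ algebraicOver (ratr : rat -> R) pi.
Proof.
move=> api.
have aipi : algebraicOver (ratr : rat -> R[i]) (Complex 0 pi).
  have -> : Complex 0 pi = Complex 0 1 * real_complex R pi.
    by apply/eqP; rewrite eq_complex/= !mulr0 !mul0r subr0 add0r mul1r !eqxx.
  apply: algebraic_mul.
    exists ('X ^+ 2 + 1%:P).
      by rewrite -size_poly_eq0 size_addl ?size_polyXn// size_polyC oner_eq0.
    rewrite rootE rmorphD rmorphXn/= map_polyX map_polyC/= rmorph1 !hornerE.
    by rewrite sqr_i addNr.
  case: api => p p0 px; exists p => //.
  have -> : map_poly (ratr : rat -> R[i]) p = map_poly (real_complex R) (map_poly ratr p).
    by rewrite -map_poly_comp; apply: eq_map_poly => x /=; rewrite fmorph_rat.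
  by rewrite fmorph_root.
have [c c0 [g gm groot]] := algebraic_monic_int aipi.
have [r rE] := closed_field_poly_normal (map_poly (intr : int -> R[i]) g).
have gE : map_poly (intr : int -> R[i]) g = \prod_(x <- in_tuple r) ('X - x%:P).
  have : map_poly (intr : int -> R[i]) g \is monic by exact: monic_map.
  by rewrite monicE => /eqP l1; rewrite {1}rE l1 scale1r.
have [P PE] := subset_sum_poly gE.
have := hermite_lindemann c0 PE (subset_sum_int gE); move=> /(_ _)/negP; apply.
  (* The empty subset provides the required zero exponent. *)
  by exists finset.set0; rewrite /subset_sum finset.big_set0.
(* The factor belonging to [i * pi] vanishes, as [cexp (i * pi) = -1]; distributing the product over
   subsets gives the sum of exponentials of subset sums. *)
have : \prod_(i < size r) (cexp (tnth (in_tuple r) i / c%:~R) + 1) == 0.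
  have : c%:~R * Complex 0 pi \in r.
    by move: groot; rewrite gE root_prod_XsubC.
  move=> /(nthP 0)[i ir iE]; apply/prodf_eq0; exists (Ordinal ir) => //.
  rewrite (tnth_nth 0)/= iE mulrC mulKf ?intr_eq0// cexp_ipi addNr.
  by [].
rewrite bigA_distr/=; congr (_ == _); apply: eq_bigr => S _.
rewrite -big_mkcond/= -cexp_sum; congr cexp.
by rewrite mulr_suml.
Qed.

End pi_transcendental.

(** * Counting transcendental constants *)

Section algebraic_dependence.
Context {F E : fieldType} (FtoE : {rmorphism F -> E}).
Local Notation alg := (algebraicOver FtoE).

Lemma algebraic_sum (I : Type) (r : seq I) (P : pred I) (G : I -> E) :
  (forall i, P i -> alg (G i)) -> alg (\sum_(i <- r | P i) G i).
Proof.
by move=> h; elim/big_ind: _ => //; [exact: algebraic0|exact: algebraic_add].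
Qed.

(** The kernel vector must have algebraic entries, so Gaussian elimination is done one column at a
    time with field operations, which preserve algebraicity. *)
Lemma algebraic_kernel r n (A : 'M[E]_(n, r)) : (r < n)%N ->
  (forall i j, alg (A i j)) ->
  exists2 c : 'rV[E]_n, c != 0 & (forall i, alg (c 0 i)) /\ c *m A = 0.
Proof.
elim: r n A => [|r IHr] [//|n] A rn Aalg.
  exists (const_mx 1); last by split=> [i|]; [rewrite mxE;
    exact: algebraic1|rewrite thinmx0].
  by apply/eqP => /rowP/(_ 0)/eqP; rewrite !mxE oner_eq0.
have [A0|[k Ak]] : (forall i, A i 0 = 0) \/ exists k, A k 0 != 0.
- have [[k Ak]|h] := pselect (exists k, A k 0 != 0); [by right; exists k|left => i].
  by apply/eqP/negPn/negP => Ai; apply: h; exists i.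
- have [|c c0 [calg cA]] := IHr _ (col' 0 A) (ltnW rn).
    by move=> i j; rewrite mxE.
  exists c => //; split => //; apply/rowP => j; rewrite !mxE.
  case: (unliftP 0 j) => [j' ->|->]; last by rewrite big1// => i _; rewrite A0 mulr0.
  move/rowP: cA => /(_ j'); rewrite !mxE => cA; rewrite -[RHS]cA.
  by apply: eq_bigr => i _; rewrite !mxE.
pose t i := A (lift k i) 0 / A k 0.
have talg i : alg (t i) by exact: algebraic_div.
pose B := \matrix_(i < n, j < r) (A (lift k i) (lift 0 j) - t i * A k (lift 0 j)).
have [|c c0 [calg cB]] := IHr n B rn.
  by move=> i j; rewrite mxE; apply: algebraic_sub => //; exact: algebraic_mul.
(* The coefficient of the pivot row is forced by the requirement that column 0 cancel. *)
pose ck := - \sum_i c 0 i * t i.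
pose c' : 'rV[E]_n.+1 := \row_i if unlift k i is Some i' then c 0 i' else ck.
have c'k : c' 0 k = ck by rewrite mxE unlift_none.
have c'l i : c' 0 (lift k i) = c 0 i by rewrite mxE liftK.
exists c'.
  apply: contra_neq c0 => /rowP h; apply/rowP => i.
  by have := h (lift k i); rewrite c'l !mxE.
split=> [i|].
  case: (unliftP k i) => [i' ->|->]; first by rewrite c'l.
  by rewrite c'k; apply/algebraic_opp/algebraic_sum => j _; exact: algebraic_mul.
have ckE j : ck * A k j = - \sum_i c 0 i * (t i * A k j).
  by rewrite mulNr mulr_suml; congr (- _); apply: eq_bigr => i _; rewrite mulrA.
apply/rowP => j; rewrite [LHS]mxE (bigD1_ord k)//= c'k ckE addrC.
under eq_bigr do rewrite c'l.
rewrite -sumrB [RHS]mxE; case: (unliftP 0 j) => [j' ->|->].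
  move/rowP: cB => /(_ j'); rewrite !mxE => cB; rewrite -[RHS]cB.
  by apply: eq_bigr => i _; rewrite mxE mulrBr.
by rewrite big1// => i _; rewrite divfK// subrr.
Qed.

(** Each unordered pair, repetition allowed, is listed once; listing ordered pairs would double the
    leading term of the count and weaken the final bound. *)
Fixpoint pair_products (s : seq E) : seq E :=
  if s is x :: s' then [seq x * y | y <- s] ++ pair_products s' else [::].

Lemma size_pair_products s : size (pair_products s) = 'C((size s).+1, 2).
Proof.
by elim: s => //= x s IHs; rewrite size_cat /= size_map IHs [RHS]binS bin1 addnS addnC.
Qed.

Lemma mem_pair_products s x y : x \in s -> y \in s -> x * y \in pair_products s.
Proof.
elim: s => //= z s IHs; rewrite !inE mem_cat => /predU1P[->|xs] /predU1P[->|ys].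
- by rewrite eqxx.
- by rewrite map_f ?orbT.
- by rewrite mulrC map_f ?orbT.
- by rewrite IHs// !orbT.
Qed.

Definition algebraic_span (z : seq E) (x : E) :=
  exists2 a : nat -> E, (forall i, alg (a i)) & x = \sum_(i < size z) a i * z`_i.

Lemma algebraic_span_mem z a x : alg a -> x \in z -> algebraic_span z (a * x).
Proof.
move=> aa /(nthP 0)[i iz <-].
exists (fun j => if j == i then a else 0).
  by move=> j; case: eqP => _ //; exact: algebraic0.
rewrite (bigD1 (Ordinal iz))//= eqxx big1 ?addr0// => j ji.
by rewrite ifN ?mul0r//; apply: contra ji => /eqP h; apply/eqP/val_inj.
Qed.

Lemma algebraic_span_sum z (I : Type) (r : seq I) (G : I -> E) :
  (forall i, algebraic_span z (G i)) -> algebraic_span z (\sum_(i <- r) G i).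
Proof.
move=> h; elim/big_ind: _ => //.
  by exists (fun=> 0); [move=> _; exact: algebraic0|rewrite big1// => i _; rewrite mul0r].
move=> _ _ [a aa ->] [b ba ->]; exists (fun i => a i + b i).
  by move=> i; exact: algebraic_add.
by rewrite -big_split/=; apply: eq_bigr => i _; rewrite mulrDl.
Qed.

Lemma algebraic_trans_root (p : {poly E}) u :
  p != 0 -> (forall i, alg p`_i) -> root p u -> alg u.
Proof.
move=> p0 pa pu; apply/integral_algebraic; apply: integral_root p0 pu _.
by move=> _ /(nthP 0)[i _ <-]; apply/integral_algebraic.
Qed.

(** With more powers than generators, [algebraic_kernel] gives a relation among the powers of [u]: a
    polynomial with algebraic coefficients vanishing at [u], nonzero because no [q i] is. *)
Lemma transcendental_powers_span (u : E) (z : seq E) n (q : nat -> E) : ~ alg u ->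
  (forall i, alg (q i)) -> (forall i, q i != 0) ->
  (forall i, (i < n)%N -> algebraic_span z (q i * u ^+ i)) -> (n <= size z)%N.
Proof.
move=> nu qa q0 h; rewrite leqNgt; apply/negP => zn; apply: nu.
have {}h i : exists a : nat -> E, (forall j, alg (a j)) /\
    ((i < n)%N -> q i * u ^+ i = \sum_(j < size z) a j * z`_j).
  have [/h[a aa aE]|_] := ltnP i n; first by exists a.
  by exists (fun=> 0); split=> // j; exact: algebraic0.
have [a aP] := choice h.
have [|c c0 [ca cA]] := @algebraic_kernel _ _ (\matrix_(i < n, j < size z) a i j) zn.
  by move=> i j; rewrite mxE; case: (aP i).
pose p := \poly_(i < n) (if insub i is Some i' then c 0 i' * q i else 0).
have pE (i : 'I_n) : p`_i = c 0 i * q i by rewrite coef_poly ltn_ord valK.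
have pge i : (n <= i)%N -> p`_i = 0 by move=> ni; rewrite coef_poly ltnNge ni.
apply: (@algebraic_trans_root p).
- apply: contra_neq c0 => p0; apply/rowP => i; apply: (mulIf (q0 i)).
  by rewrite -pE p0 coef0 mxE mul0r.
- move=> i; have [ni|ni] := leqP n i; first by rewrite pge//; exact: algebraic0.
  by rewrite (pE (Ordinal ni)); exact: algebraic_mul.
rewrite rootE (@horner_coef_wide _ n); last exact/leq_sizeP.
rewrite (eq_bigr (fun i : 'I_n => \sum_(j < size z) c 0 i * a i j * z`_j)); last first.
  move=> i _; rewrite pE -mulrA (aP i).2// mulr_sumr.
  by apply: eq_bigr => j _; rewrite mulrA.
rewrite exchange_big big1// => j _; rewrite -mulr_suml.
move/rowP: cA => /(_ j); rewrite !mxE => cA.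
rewrite (_ : \sum_i _ = 0) ?mul0r// -[RHS]cA.
by apply: eq_bigr => i _; rewrite mxE.
Qed.
End algebraic_dependence.

(** * The four assertions about the constants *)

Section main.
Context {R : realType}.
Local Notation mu := (@lebesgue_measure R).
Local Notation alg := (algebraicOver (ratr : rat -> R)).
Local Notation gam := (gamma_const R).

Lemma gamma_const0 : gam 0 = 1.
Proof.
rewrite /gamma_const /Rintegral.
under eq_integral do rewrite expr0 mul1r.
have dF (x : R) : is_derive x 1 (fun x => expR (- expR (- x))) (gumbel x).
  by apply: is_derive_eq; rewrite /gumbel expRD /GRing.scale/=; ring.
rewrite (@ge0_continuous_FTC2T _ _ (fun x => expR (- expR (- x))) 1 0 _ _ dF)/= ?subr0//.
- by move=> x; rewrite /gumbel expR_ge0.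
- exact: continuous_gumbel.
- rewrite -expR0 -[X in expR X]oppr0.
  apply: (cvgy_comp_expRN (G := fun p => expR (- p))) => //.
  exact: is_derive_continuous.
- apply/cvgNy_compNP; under [X in X @ _]eq_fun do rewrite /= opprK.
  exact: (cvg_comp _ _ cvgy_expR (@cvgr_expR R)).
Qed.

Lemma pi2_transcendental : ~ alg (pi ^+ 2).
Proof.
move=> h; apply: (@pi_transcendental R).
apply: (@algebraic_trans_root _ _ (ratr : {rmorphism rat -> R}) ('X^2 - (pi ^+ 2)%:P)).
- by rewrite -size_poly_eq0 size_XnsubC.
- move=> i; rewrite coefB coefXn coefC; apply: algebraic_sub.
    by case: eqP => _; [exact: algebraic1|exact: algebraic0].
  by case: eqP => _ //; exact: algebraic0.
- by rewrite rootE !hornerE subrr.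
Qed.

Lemma gamma_const_span (s : seq R) N : 1 \in s ->
  (forall k, (1 <= k <= N)%N -> ~ alg (gam k) -> gam k \in s) ->
  (N./2.+1 <= 'C((size s).+1, 2))%N.
Proof.
move=> s1 hs; rewrite -size_pair_products.
(* An algebraic constant is a multiple of the member 1 of [s]; a transcendental one is itself a
   member. *)
have gs k : (k <= N)%N -> exists2 a, alg a & exists2 x, x \in s & gam k = a * x.
  move=> kN; have [ak|nk] := pselect (alg (gam k)).
    by exists (gam k) => //; exists 1; rewrite ?mulr1.
  exists 1; first exact: algebraic1.
  exists (gam k); last by rewrite mul1r.
  apply: hs => //; rewrite kN andbT lt0n; apply/eqP => k0; apply: nk.
  by rewrite k0 gamma_const0; exact: algebraic1.
pose q n : rat := s2val (cid2 (@gamma_const_relation R n)).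
have q0 n : 0 < q n by rewrite /q; case: cid2.
have qE n : ratr (q n) * pi ^+ n.*2 = \sum_(k < n.*2.+1) (-1) ^+ k * 'C(n.*2, k)%:R * gam k
    * gam (n.*2 - k) by rewrite /q; case: cid2.
apply: (@transcendental_powers_span _ _ (ratr : {rmorphism rat -> R}) (pi ^+ 2) _ _ (fun
  n => ratr (q n))).
- exact: pi2_transcendental.
- by move=> n; exact: algebraic_id.
- by move=> n; rewrite fmorph_eq0 gt_eqF.
move=> n nN; rewrite -exprM mul2n qE.
apply: algebraic_span_sum => k.
have n2N : (n.*2 <= N)%N.
  by rewrite -(odd_double_half N); apply: leq_trans (leq_addl _ _); rewrite leq_double.
have [a aa [x xs ->]] : exists2 a, alg a & exists2 x, x \in s & gam k = a * x.
  by apply: gs; apply: leq_trans n2N; rewrite -ltnS.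
have [b ba [y ys ->]] : exists2 a, alg a & exists2 x, x \in s & gam (n.*2 - k) = a * x.
  by apply: gs; apply: leq_trans n2N; exact: leq_subr.
rewrite (_ : _ * _ = ratr ((-1) ^+ k * 'C(n.*2, k)%:R) * a * b * (x * y)); last first.
  by rewrite rmorphM rmorphXn rmorphN1/= ratr_nat; ring.
apply: algebraic_span_mem; last exact: mem_pair_products.
by do 2![apply: algebraic_mul => //]; exact: algebraic_id.
Qed.

Lemma transcendental_count_bound N :
  (N./2.+1 <= 'C((transcendental_count R N).+2, 2))%N.
Proof.
pose P n := `[< transcendental (gam n) >].
have := @gamma_const_span (1 :: [seq gam n | n <- index_iota 1 N.+1 & P n]) N.
rewrite /= size_map size_filter; apply; first by rewrite inE eqxx.
move=> k kN nk; rewrite inE; apply/orP; right; apply/map_f.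
by rewrite mem_filter mem_index_iota kN andbT; apply/asboolP.
Qed.

(** Combines [N <= 2 * N./2 + 1] with [2 * (N./2 + 1) <= (m + 2) * (m + 1)]. *)
Lemma transcendental_count_sqr N m : transcendental_count R N = m ->
  (N <= m ^ 2 + 3 * m + 1)%N.
Proof.
move=> cE; have := transcendental_count_bound N; rewrite cE bin2/= => h.
have h1 : (N./2.+1.*2 <= (m.+2 * m.+1)./2.*2)%N by rewrite leq_double.
have h2 : ((m.+2 * m.+1)./2.*2 <= m.+2 * m.+1)%N.
  by rewrite -[leqRHS]odd_double_half leq_addl.
have := odd_double_half N; rewrite -mulnn; move: (leq_b1 (odd N)).
lia.
Qed.

(** Completing the square, [N - 1 <= m ^ 2 + 3 * m <= (m + 3 / 2) ^ 2]; hence the constant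
    [3 / 2]. *)
Lemma transcendental_count_lower N : (1 <= N)%N ->
  Num.sqrt (N%:R - 1) - 3 / 2 <= (transcendental_count R N)%:R :> R.
Proof.
move=> N1; have := transcendental_count_sqr (erefl (transcendental_count R N)).
set m := transcendental_count R N => h.
have : N%:R <= (m ^ 2 + 3 * m + 1)%N%:R :> R by rewrite ler_nat.
rewrite -mulnn !natrD !natrM => hR.
have m0 : 0 <= m%:R :> R by [].
rewrite lerBlDr -[leRHS]ger0_norm; last by lra.
by rewrite -sqrtr_sqr ler_sqrt ?sqr_ge0//; nra.
Qed.

Lemma Qpoly_rat k (a : 'I_k -> R) (q : rat) : Qpoly a (ratr q).
Proof. by exists (mpoly.mpolyC k q); rewrite mpoly.mmapC. Qed.

Lemma Qpoly_var k (a : 'I_k -> R) i : Qpoly a (a i).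
Proof.
exists (mpoly.mpolyX rat (mpoly.mnm1 i)).
by rewrite mpoly.mmapX mpoly.mmap1U.
Qed.

Lemma QpolyD k (a : 'I_k -> R) x y : Qpoly a x -> Qpoly a y -> Qpoly a (x + y).
Proof. by move=> [p ->] [q ->]; exists (p + q); rewrite raddfD. Qed.

Lemma QpolyM k (a : 'I_k -> R) x y : Qpoly a x -> Qpoly a y -> Qpoly a (x * y).
Proof. by move=> [p ->] [q ->]; exists (p * q); rewrite rmorphM. Qed.

Lemma QpolyX k (a : 'I_k -> R) x n : Qpoly a x -> Qpoly a (x ^+ n).
Proof.
move=> ax; elim: n => [|n IHn]; last by rewrite exprS; exact: QpolyM.
by rewrite expr0 -(rmorph1 (ratr : rat -> R)); exact: Qpoly_rat.
Qed.

Lemma Qpoly_sum k (a : 'I_k -> R) m (P : pred 'I_m) (F : 'I_m -> R) :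
  (forall i, P i -> Qpoly a (F i)) -> Qpoly a (\sum_(i | P i) F i).
Proof.
move=> h; elim/big_ind: _ => //; last exact: QpolyD.
by rewrite -(rmorph0 (ratr : rat -> R)); exact: Qpoly_rat.
Qed.

Lemma gamma_const_Qpoly n : (2 <= n)%N ->
  Qpoly (fun i : 'I_(2 * n - 1) => gam i.+1) (gam (2 * n)).
Proof.
move=> n2; set a := fun i => _.
have var k : (0 < k < n.*2)%N -> Qpoly a (gam k).
  move=> /andP[k0 kn]; have kn' : (k.-1 < 2 * n - 1)%N by lia.
  by have := Qpoly_var a (Ordinal kn'); rewrite /a/= prednK.
have [q1 q10 E1] := @gamma_const_relation R 1.
have pi2 : Qpoly a (pi ^+ 2).
  (* The relation of order 1 reads [2 * gam 2 - 2 * gam 1 ^+ 2 = q1 * pi ^+ 2]; both indices lie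
     below [2 * n] because [2 <= n]. *)
  have -> : pi ^+ 2 = ratr (2 / q1) * (gam 2 + ratr (-1) * (gam 1 * gam 1)).
    apply: (mulfI (_ : ratr q1 != 0)); first by rewrite fmorph_eq0 gt_eqF.
    rewrite -[pi ^+ 2]/(pi ^+ 1.*2) -E1 !big_ord_recl big_ord0 /= gamma_const0.
    rewrite -[bump 0 0]/1%N -[bump 0 1]/2%N -[1.*2]/2%N bin0 bin1 binn.
    rewrite rmorphN1 fmorph_div/= ratr_nat; field.
    by rewrite fmorph_eq0 gt_eqF.
  apply: QpolyM; first exact: Qpoly_rat.
  apply: QpolyD; first by apply: var; lia.
  apply: QpolyM; first exact: Qpoly_rat.
  by apply: QpolyM; apply: var; lia.
have [q q0] := @gamma_const_relation R n.
(* Since [gam 0 = 1], the two extreme terms each equal [gam (2 * n)]; all other indices are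
   smaller. *)
rewrite (bigD1 ord0)//= (bigD1 ord_max)/=; last by rewrite -val_eqE/= double_eq0; lia.
rewrite subn0 subnn gamma_const0 expr0 bin0 binn -signr_odd odd_double expr0.
rewrite !mul1r !mulr1 -mul2n => E.
have -> : gam (2 * n) = ratr 2^-1 * (ratr q * (pi ^+ 2) ^+ n + ratr (-1) *
    \sum_(i < (2 * n).+1 | (i != ord0) && (i != ord_max))
      (-1) ^+ i * 'C(2 * n, i)%:R * gam i * gam (2 * n - i)).
  by rewrite -exprM -E fmorphV rmorphN1/= ratr_nat; field.
apply: QpolyM; first exact: Qpoly_rat.
apply: QpolyD.
  by apply: QpolyM; [exact: Qpoly_rat|exact: QpolyX].
apply: QpolyM; first exact: Qpoly_rat.
apply: Qpoly_sum => i /andP[i0 im].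
have {}i0 : (0 < i)%N by rewrite lt0n.
have {}im : (i < 2 * n)%N by rewrite ltn_neqAle -ltnS ltn_ord andbT.
rewrite (_ : (-1) ^+ i * _ = ratr ((-1) ^+ i * 'C(2 * n, i)%:R)); last first.
  by rewrite rmorphM rmorphXn rmorphN1/= ratr_nat.
by apply: QpolyM; [apply: QpolyM; [exact: Qpoly_rat|apply: var; lia]|apply: var; lia].
Qed.

Lemma infinite_transcendental :
  infinite_set [set n : nat | (1 <= n)%N /\ transcendental (gam n)].
Proof.
move=> /finite_seqP[s sE].
(* One more than the largest [N] that [size s] transcendental constants permit. *)
pose N := ((size s) ^ 2 + 3 * size s + 2)%N.
have ms : (transcendental_count R N <= size s)%N.
  rewrite /transcendental_count -size_filter.
  apply: uniq_leq_size; first by rewrite filter_uniq// iota_uniq.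
  move=> n; rewrite mem_filter mem_index_iota => /andP[/asboolP tn /andP[n1 _]].
  by have : [set` s] n by rewrite -sE.
have := transcendental_count_sqr (erefl (transcendental_count R N)).
move: (transcendental_count R N) ms => m ms; have := leq_mul ms ms.
by rewrite /N -!mulnn; lia.
Qed.

(** If neither were transcendental, the bound at [N = 2] would say [2 <= 1]. *)
Lemma transcendental_pair : transcendental (gam 1) \/ transcendental (gam 2).
Proof.
have := transcendental_count_bound 2.
rewrite /transcendental_count/=.
have [t1|nt1] := pselect (transcendental (gam 1)); first by left.
have [t2|nt2] := pselect (transcendental (gam 2)); first by right.
by rewrite !asboolF.
Qed.

Lemma beta_asymp : asymp (beta R) (fun N : nat => N%:R `^ (- (1 / 2))).
Proof.
exists (1 / 2), 1; split=> //; near=> N.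
(* From [s >= 5] follows [t - 3 / 2 >= s - 5 / 2 >= s / 2], whence the lower constant [1 / 2]. *)
have N25 : (25 <= N)%N by near: N; exact: nbhs_infty_ge.
have N25R : 25 <= N%:R :> R by rewrite ler_nat.
rewrite powRN mul1r powR12_sqrt// /beta.
set s := Num.sqrt N%:R.
have s5 : 5 <= s.
  by rewrite -[5]ger0_norm// -sqrtr_sqr ler_sqrt//; lra.
have sN : s ^+ 2 = N%:R by rewrite sqr_sqrtr.
set t := Num.sqrt (N%:R - 1).
have ts : t <= s by rewrite ler_sqrt; lra.
have st : s - 1 <= t.
  by rewrite -[s - 1]ger0_norm ?subr_ge0; [rewrite -sqrtr_sqr ler_sqrt; nra|lra].
rewrite invrK -sN (_ : _ / s ^+ 2 * s = Num.max 0 (t - 3 / 2) / s); last first.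
  by field; rewrite gt_eqF//; lra.
have s0 : 0 < s by lra.
by rewrite ler_pdivlMr// ler_pdivrMr// le_max ge_max; apply/andP; split; [apply/orP;
  right|apply/andP; split]; lra.
Unshelve. all: by end_near. Qed.

End main.

Theorem theorem1 (R : realType) :
  [/\ transcendental (gamma_const R 1) \/ transcendental (gamma_const R 2),
      forall n : nat, (2 <= n)%N ->
        Qpoly (fun i : 'I_(2 * n - 1) => gamma_const R i.+1)
          (gamma_const R (2 * n)),
      infinite_set
        [set n : nat | (1 <= n)%N /\ transcendental (gamma_const R n)] &
      (forall N : nat, (1 <= N)%N ->
        (transcendental_count R N)%:R / N%:R >= beta R N) /\
      asymp (beta R) (fun N : nat => N%:R `^ (- (1 / 2)))].
Proof.
split; [exact: transcendental_pair|exact: gamma_const_Qpoly|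
  exact: infinite_transcendental|split; last exact: beta_asymp].
move=> N N1; rewrite /beta ler_pM2r ?invr_gt0 ?ltr0n// ge_max ler0n/=.
exact: transcendental_count_lower.
Qed.
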